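(* Let $d\in\{1,3\}$. Let $\Phi$ be the solution of the exterior problem $$ \left\{ \begin{array}{l} -\nu\Delta \Phi=\rho_{\infty}\left(e^{-\Phi}-e^{\Phi}\right),\quad \boldsymbol{x}\in \Omega,\\ -\dfrac{\partial \Phi}{\partial \boldsymbol{n}}\Big|_{\Gamma} =\sigma_f,\qquad \Phi(\boldsymbol{x})\rightarrow 0 \ \text{as} \ |\boldsymbol{x}| \rightarrow \infty, \end{array} \right. $$ and, for $L$ such that $\bar{\mathcal{C}}\subset B_L$, let $\Phi_L$ be the solution of the truncated problem $$ \left\{ \begin{array}{l} -\nu\Delta \Phi_L=\rho_{\infty}\left(e^{-\Phi_L}-e^{\Phi_L}\right),\quad \boldsymbol{x}\in \Omega_L,\\ -\dfrac{\partial \Phi_L}{\partial \boldsymbol{n}}\Big|_{\Gamma} =\sigma_f,\qquad \dfrac{\partial \Phi_L}{\partial \boldsymbol{n}}\Big|_{\partial B_L} =0. \end{array} \right. $$ Then there exist constants $C_1>0$, $C_2>0$ independent of $L$ such that $$ \|\Phi_L-\Phi\|_{L^1(\Omega_L)}\leq C_2\, e^{-\frac{C_1}{\sqrt{\nu}} L} $$ for all $L$ large enough.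
   Context: $\nu>0$ and $\rho_\infty>0$ are fixed constants. $\mathcal{C}\subset\mathbb{R}^d$ is a fixed bounded open set (a bounded open interval if $d=1$) with smooth boundary $\Gamma=\partial\mathcal{C}$, and $\Omega=\mathbb{R}^d\setminus\bar{\mathcal{C}}$. For $L>0$, $B_L=\{\boldsymbol{x}\in\mathbb{R}^d:|\boldsymbol{x}|<L\}$ and $\Omega_L=B_L\setminus\bar{\mathcal{C}}$. On $\Gamma$, $\boldsymbol{n}$ is the unit normal pointing out of $\mathcal{C}$ (into $\Omega$); on $\partial B_L$, $\boldsymbol{n}$ is the unit normal pointing out of $B_L$. $\sigma_f$ is a given bounded function on $\Gamma$, independent of $L$: it is the equivalent effective surface charge of a fixed charge distribution $\rho_f$ inside $\mathcal{C}$ (assumed radially symmetric when $d=3$; no symmetry of $\rho_f$ is needed when $d=1$), and satisfies $\nu\oint_\Gamma\sigma_f\,\mathrm{d}S=Q_f:=\int_{\mathcal{C}}\rho_f\,\mathrm{d}\boldsymbol{x}$. For $d=1$, $\sigma_f$ is a constant (the same value $Q_f/(2\nu)$ at both endpoints). The charge $\rho_f$ enters the two boundary value problems only through $\sigma_f$. Solutions are understood in the classical sense. *)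

(* Defs.v *)
From HB Require Import structures.
From mathcomp Require Import all_boot all_order all_algebra.
From mathcomp Require Import all_classical all_reals all_analysis.

Set Implicit Arguments.
Unset Strict Implicit.
Unset Printing Implicit Defensive.
Import Order.TTheory GRing.Theory Num.Theory.
Import numFieldNormedType.Exports.

Local Open Scope classical_set_scope.
Local Open Scope ring_scope.

(** Points are row vectors.  The library norm of ['rV[R]_d] is the maximum
    norm; it induces the usual topology, but the balls and normals below are
    Euclidean. *)

Definition enorm (R : realType) (d : nat) (x : 'rV[R]_d) : R :=
  Num.sqrt (\sum_(i < d) x ord0 i ^+ 2).

Definition eball (R : realType) (d : nat) (L : R) : set 'rV[R]_d :=
  [set x : 'rV[R]_d | enorm x < L].

Definition boundary (T : topologicalType) (A : set T) : set T :=
  closure A `\` interior A.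

(** Outer measure generated by a gauge on arbitrary sets: the infimum of
    [\sum_k zeta (A k)] over all countable covers.  Every set is measurable in
    [g_sigma_algebraType setT], so [mu_ext] does not restrict the covers.  The
    empty set gets gauge [0], as is usual for the exponent [0]. *)
Definition cover_measure (R : realType) (T : pointedType)
    (zeta : set T -> \bar R) (A : set T) : \bar R :=
  @mu_ext _ (g_sigma_algebraType [set: set T]) R
    (fun U => if `[< U = set0 >] then 0%E else zeta U) A.

Section cover_measure_lemmas.
Variables (R : realType) (T : pointedType) (zeta : set T -> \bar R).
Hypothesis zeta_ge0 : forall U, (0 <= zeta U)%E.

Let gauge (U : set T) : \bar R := if `[< U = set0 >] then 0%E else zeta U.

Let gauge0 : gauge set0 = 0%E.
Proof. by rewrite /gauge; case: asboolP. Qed.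

Let gauge_ge0 U : (0 <= gauge U)%E.
Proof. by rewrite /gauge; case: asboolP. Qed.

Lemma cover_measure0 : cover_measure zeta set0 = 0%E.
Proof.
exact: (@mu_ext0 _ (g_sigma_algebraType [set: set T]) R _ gauge0 gauge_ge0).
Qed.

Lemma cover_measure_ge0 A : (0 <= cover_measure zeta A)%E.
Proof.
exact: (@mu_ext_ge0 _ (g_sigma_algebraType [set: set T]) R _ gauge_ge0).
Qed.

Lemma le_cover_measure :
  {homo cover_measure zeta : A B / A `<=` B >-> (A <= B)%E}.
Proof. exact: (@le_mu_ext _ (g_sigma_algebraType [set: set T]) R gauge). Qed.

Lemma cover_measure_sigma_subadditive : sigma_subadditive (cover_measure zeta).
Proof.
exact: (@mu_ext_sigma_subadditive _ (g_sigma_algebraType [set: set T]) R _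
  gauge_ge0).
Qed.

End cover_measure_lemmas.

Section lebesgue.
Variables (R : realType) (d : nat).
Local Notation V := 'rV[R]_d.

Definition box (a b : V) : set V :=
  [set x : V | forall i, a ord0 i <= x ord0 i < b ord0 i].

(** The infimum is [+oo] when [U] is not a box. *)
Definition box_volume (U : set V) : \bar R :=
  ereal_inf [set v : \bar R | exists a b : V,
    [/\ forall i, a ord0 i <= b ord0 i, U = box a b &
        v = (\prod_(i < d) (b ord0 i - a ord0 i))%:E]].

Definition lebesgue_outer (A : set V) : \bar R := cover_measure box_volume A.

Lemma box_volume_ge0 U : (0 <= box_volume U)%E.
Proof.
apply: le_ereal_inf_tmp => _ [a [b [ab _ ->]]].
by rewrite lee_fin prodr_ge0// => i _; rewrite subr_ge0.
Qed.

HB.instance Definition _ := isOuterMeasure.Build R V lebesgue_outer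
  (cover_measure0 box_volume_ge0) (cover_measure_ge0 box_volume_ge0)
  (@le_cover_measure _ _ box_volume)
  (cover_measure_sigma_subadditive box_volume_ge0).

Definition lebesgue_outer_measure : {outer_measure set V -> \bar R} :=
  lebesgue_outer.

(** Lebesgue measure, on the Caratheodory (i.e., Lebesgue measurable) sets. *)
Definition lebesgue :
    {measure set (caratheodory_type lebesgue_outer_measure) -> \bar R} :=
  lebesgue_outer_measure.

End lebesgue.
Arguments lebesgue {R d}.

Section hausdorff.
Variables (R : realType) (d : nat).
Local Notation V := 'rV[R]_d.

(** Volume of the unit ball of [R^s]:
    [w_0 = 1], [w_1 = 2], [w_(s+2) = 2 pi w_s / (s + 2)]. *)
Fixpoint unit_ball_volume (s : nat) : R :=
  match s with
  | 0 => 1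
  | 1 => 2
  | (s'.+1 as t).+1 => 2 * pi / (t.+1)%:R * unit_ball_volume s'
  end.

Definition diam (U : set V) : R :=
  sup [set r | exists x y, [/\ U x, U y & r = enorm (x - y)]].

Definition hausdorff_gauge (s : nat) (delta : R) (U : set V) : \bar R :=
  if `[< forall x y, U x -> U y -> enorm (x - y) <= delta >]
  then (unit_ball_volume s * (diam U / 2) ^+ s)%:E else +oo%E.

Definition hausdorff_outer (s : nat) (A : set V) : \bar R :=
  ereal_sup [set cover_measure (hausdorff_gauge s delta) A |
             delta in [set delta : R | 0 < delta]].

Lemma unit_ball_volume_ge0 s : 0 <= unit_ball_volume s.
Proof.
suff : 0 <= unit_ball_volume s /\ 0 <= unit_ball_volume s.+1 by case.
elim: s => [|s [IH1 IH2]]; split => //=.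
by rewrite mulr_ge0// divr_ge0// mulr_ge0// pi_ge0.
Qed.

Lemma diam_ge0 U : 0 <= diam U.
Proof.
rewrite /diam; set D := [set _ | _].
have D0 r : D r -> 0 <= r by move=> [x [y [_ _ ->]]]; exact: sqrtr_ge0.
have [hD|nD] := pselect (has_sup D); last by rewrite sup_out.
have [[r Dr] uD] := hD.
by rewrite (le_trans (D0 _ Dr))// ub_le_sup.
Qed.

Lemma hausdorff_gauge_ge0 s delta U : (0 <= hausdorff_gauge s delta U)%E.
Proof.
rewrite /hausdorff_gauge; case: asboolP => _; last exact: leey.
by rewrite lee_fin mulr_ge0 ?unit_ball_volume_ge0// exprn_ge0// divr_ge0//
  diam_ge0.
Qed.

Lemma hausdorff_outer0 s : hausdorff_outer s set0 = 0%E.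
Proof.
have g0 delta := hausdorff_gauge_ge0 s delta.
rewrite /hausdorff_outer; apply/eqP; rewrite eq_le; apply/andP; split.
  by apply: ge_ereal_sup => _ [delta _ <-]; rewrite (cover_measure0 (g0 delta)).
apply: ereal_sup_ubound; exists 1 => //=.
by rewrite (cover_measure0 (g0 1)).
Qed.

Lemma hausdorff_outer_ge0 s A : (0 <= hausdorff_outer s A)%E.
Proof.
have g0 := hausdorff_gauge_ge0 s 1.
apply: (le_trans (cover_measure_ge0 g0 A)).
by apply: ereal_sup_ubound; exists 1 => //=.
Qed.

Lemma le_hausdorff_outer s :
  {homo hausdorff_outer s : A B / A `<=` B >-> (A <= B)%E}.
Proof.
move=> A B AB; apply: ge_ereal_sup => _ [delta d0 <-].
apply: (le_trans (le_cover_measure _ AB)).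
by apply: ereal_sup_ubound; exists delta.
Qed.

Lemma hausdorff_outer_sigma_subadditive s :
  sigma_subadditive (hausdorff_outer s).
Proof.
move=> F; apply: ge_ereal_sup => _ [delta d0 <-].
have g0 := hausdorff_gauge_ge0 s delta.
apply: (le_trans (cover_measure_sigma_subadditive g0 F)).
apply: lee_nneseries => [i _ _|i _]; first exact: cover_measure_ge0 g0 _.
by apply: ereal_sup_ubound; exists delta.
Qed.

HB.instance Definition _ s := isOuterMeasure.Build R V (hausdorff_outer s)
  (hausdorff_outer0 s) (hausdorff_outer_ge0 s) (@le_hausdorff_outer s)
  (@hausdorff_outer_sigma_subadditive s).

Definition hausdorff_outer_measure (s : nat) :
    {outer_measure set V -> \bar R} := hausdorff_outer s.

Definition hausdorff (s : nat) :
    {measure set (caratheodory_type (hausdorff_outer_measure s)) -> \bar R} :=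
  hausdorff_outer_measure s.

End hausdorff.
Arguments hausdorff {R d}.

(** Surface measure [dS] on hypersurfaces of [R^d]; it is the counting measure
    when [d = 1]. *)
Definition surface (R : realType) (d : nat) := @hausdorff R d d.-1.
Arguments surface {R d}.

Section calculus.
Variables (R : realType) (d : nat).
Local Notation V := 'rV[R]_d.
Implicit Types (f : V -> R) (U A : set V) (x n : V).

Definition unit_vector (i : 'I_d) : V := delta_mx ord0 i.

Definition partial (i : 'I_d) f (x : V) : R := 'D_(unit_vector i) f x.

Definition gradient f (x : V) : V := \row_(i < d) partial i f x.

Definition laplacian f (x : V) : R := \sum_(i < d) partial i (partial i f) x.

(** For [U] open: the partial derivatives of order at most [k] exist and are
    continuous on [U]. *)
Fixpoint class_C (k : nat) U f : Prop :=
  (forall x, U x -> {for x, continuous f}) /\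
  match k with
  | 0 => True
  | k'.+1 => forall i, (forall x, U x -> derivable f x (unit_vector i)) /\
                       class_C k' U (partial i f)
  end.

Definition smooth_on U f : Prop := forall k, class_C k U f.

(** [f] and its gradient on [U] extend continuously to the closure of [U]. *)
Definition C1_up_to_boundary U f : Prop :=
  {within closure U, continuous f} /\
  exists G : V -> V, {within closure U, continuous G} /\
                     forall x, U x -> gradient f x = G x.

Definition classical U f : Prop := class_C 2 U f /\ C1_up_to_boundary U f.

(** [g] is a smooth regular function on the neighbourhood [U] of [x], negative
    exactly on [A]: there the boundary of [A] is the hypersurface [g = 0], with
    [A] on one side only. *)
Definition local_defining_function A x U (g : V -> R) : Prop :=
  [/\ open U, U x, smooth_on U g,
      forall y, U y -> gradient g y != 0 &
      forall y, U y -> (A y <-> g y < 0)].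

Definition smooth_boundary A : Prop :=
  forall x, boundary A x -> exists U g, local_defining_function A x U g.

Definition outer_unit_normal A x n : Prop :=
  enorm n = 1 /\
  exists U g, local_defining_function A x U g /\
    exists lambda : R, 0 < lambda /\ gradient g x = lambda *: n.

(** [df] is the derivative at [x] along [n] of a function [f] on [U], where
    [x] is a boundary point of [U]: the difference quotient only involves points
    of [U], hence [t > 0] if [n] points into [U] and [t < 0] if it points out
    of [U]. *)
Definition is_normal_derivative U f x n (df : R) : Prop :=
  (fun t : R => t^-1 * (f (x + t *: n) - f x))
    @ within [set t | U (x + t *: n)] 0^' --> df.

(** The derivative of [f] (a function on [U]) along the unit normal pointing
    out of [A] is [h] on the boundary of [A]. *)
Definition neumann_condition U f A (h : V -> R) : Prop :=
  forall x n, boundary A x -> outer_unit_normal A x n ->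
    is_normal_derivative U f x n (h x).

Definition vanishes_at_infinity U f : Prop :=
  forall eps : R, 0 < eps ->
    exists M : R, forall x, U x -> M <= enorm x -> `|f x| <= eps.

End calculus.

Section poisson_boltzmann.
Variables (R : realType) (d : nat).
Local Notation V := 'rV[R]_d.
Variables (nu rho_inf : R) (C : set V) (sigma_f : V -> R).

Definition Omega : set V := ~` closure C.
Definition Omega_ (L : R) : set V := @eball R d L `\` closure C.

Definition poisson_boltzmann (U : set V) (Phi : V -> R) : Prop :=
  forall x, U x ->
    - nu * laplacian Phi x = rho_inf * (expR (- Phi x) - expR (Phi x)).

(** Only the values on the closure of [Omega] (resp. [Omega_ L]) matter. *)
Definition exterior_solution (Phi : V -> R) : Prop :=
  [/\ classical Omega Phi,
      poisson_boltzmann Omega Phi,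
      neumann_condition Omega Phi C (fun x => - sigma_f x) &
      vanishes_at_infinity Omega Phi].

Definition truncated_solution (L : R) (Phi_L : V -> R) : Prop :=
  [/\ classical (Omega_ L) Phi_L,
      poisson_boltzmann (Omega_ L) Phi_L,
      neumann_condition (Omega_ L) Phi_L C (fun x => - sigma_f x) &
      neumann_condition (Omega_ L) Phi_L (@eball R d L) (fun=> 0)].

End poisson_boltzmann.

Definition L1_norm (R : realType) (d : nat) (D : set 'rV[R]_d)
    (f : 'rV[R]_d -> R) : \bar R :=
  (\int[lebesgue]_(x in D) `|f x|%:E)%E.

(* Main.v *)
Require Import Defs.
From mathcomp Require Import all_boot all_order all_algebra.
From mathcomp Require Import all_classical all_reals all_analysis.
From mathcomp Require Import ring lra.
Import Order.TTheory GRing.Theory Num.Theory.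
Import numFieldNormedType.Exports.
Local Open Scope classical_set_scope.
Local Open Scope ring_scope.

(** Write [k = rho_inf / nu].  Both potentials solve [Delta u = k (e^u - e^(-u))].  As
    the right-hand side increases at least linearly, the difference [w] of two solutions
    satisfies [Delta w >= k w] wherever [w > 0]; since [0] is a solution, so do a solution
    itself and its opposite.  Everything follows from maximum principles for such
    subsolutions.

    Decay ([gauss_decay]).  In a ball of radius [rho] where [|u| <= A], comparison with a
    Gaussian barrier gives [|u| <= A e^(-c rho)] at the centre.  This remains true if the
    ball is cut by the outer sphere and [u] has zero normal derivative there, because
    the barrier increases in the outward direction.  So both [Phi] and [Phi_L] are of size
    [e^(-c L / 4)] in the region [L / 2 <= |x| < L].

    Comparison ([maximum_principle], [comparison]).  For [|x| < L / 2], the difference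
    [Phi_L - Phi] has zero normal derivative on the boundary of the obstacle, whatever the
    surface charge; by the Hopf lemma ([hopf]) it has no positive maximum there.  It is
    thus bounded by its values on the sphere [|x| = L / 2], which are small by the first
    step.

    Uniformity ([truncation_error]).  The first step involves [A = max |Phi_L|], which
    might depend on [L].  But the two steps together bound [|Phi_L|] by
    [M + (A + M) e^(-c L / 4)] with [M = sup |Phi|], and so [A <= 3 M] as soon as the
    exponential is at most [1 / 2].

    The resulting uniform bound is multiplied by the volume of a box around the ball
    ([L1_norm_le]), and half of the exponential rate absorbs this power of [L]. *)

Set Implicit Arguments.
Unset Strict Implicit.

(** * Euclidean geometry in coordinates *)

Section euclid.
Context {R : realType} {d : nat}.
Implicit Types x y n : 'rV[R]_d.

Definition dot x y : R := \sum_i x ord0 i * y ord0 i.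

Definition sqnorm x : R := dot x x.

Lemma sqnormE x : sqnorm x = \sum_i x ord0 i ^+ 2.
Proof. by apply: eq_bigr => i _; rewrite expr2. Qed.

Lemma enormE x : enorm x = Num.sqrt (sqnorm x).
Proof. by rewrite sqnormE. Qed.

Lemma sqnorm0 : sqnorm 0 = 0.
Proof. by rewrite sqnormE big1// => i _; rewrite mxE expr0n. Qed.

Lemma sqnorm_ge0 x : 0 <= sqnorm x.
Proof. by rewrite sqnormE sumr_ge0// => i _; rewrite sqr_ge0. Qed.

Lemma enorm_sqr x : enorm x ^+ 2 = sqnorm x.
Proof. by rewrite enormE sqr_sqrtr// sqnorm_ge0. Qed.

Lemma enorm_ge0 x : 0 <= enorm x.
Proof. by rewrite enormE sqrtr_ge0. Qed.

Lemma enorm_lt x (L : R) : 0 <= L -> (enorm x < L) = (sqnorm x < L ^+ 2).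
Proof.
by move=> L0; rewrite -enorm_sqr ltr_pXn2r// nnegrE enorm_ge0.
Qed.

Lemma enorm_le x (L : R) : 0 <= L -> (enorm x <= L) = (sqnorm x <= L ^+ 2).
Proof.
by move=> L0; rewrite -enorm_sqr ler_pXn2r// nnegrE enorm_ge0.
Qed.

Lemma dotC x y : dot x y = dot y x.
Proof. by apply: eq_bigr => i _; rewrite mulrC. Qed.

Lemma dotDl x y n : dot (x + y) n = dot x n + dot y n.
Proof. by rewrite /dot -big_split/=; apply: eq_bigr => i _; rewrite mxE mulrDl. Qed.

Lemma dotZl (a : R) x y : dot (a *: x) y = a * dot x y.
Proof. by rewrite /dot big_distrr/=; apply: eq_bigr => i _; rewrite mxE mulrA. Qed.

Lemma dotDr x y n : dot n (x + y) = dot n x + dot n y.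
Proof. by rewrite !(dotC n) dotDl. Qed.

Lemma dotZr (a : R) x y : dot x (a *: y) = a * dot x y.
Proof. by rewrite !(dotC x) dotZl. Qed.

Lemma dotNl x y : dot (- x) y = - dot x y.
Proof. by rewrite -scaleN1r dotZl mulN1r. Qed.

Lemma dotNr x y : dot x (- y) = - dot x y.
Proof. by rewrite -scaleN1r dotZr mulN1r. Qed.

Lemma sqnorm_line x n (t : R) :
  sqnorm (x + t *: n) = sqnorm x + 2 * t * dot x n + t ^+ 2 * sqnorm n.
Proof.
by rewrite /sqnorm !dotDl !dotDr !dotZl !dotZr (dotC n x); ring.
Qed.

Lemma dot_unit_vector x i : dot x (unit_vector R i) = x ord0 i.
Proof.
rewrite /dot (bigD1 i)//= mxE !eqxx mulr1 big1 ?addr0// => j ji.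
by rewrite mxE (negbTE ji) andbF mulr0.
Qed.

Lemma sqnorm_coord x i : x ord0 i ^+ 2 <= sqnorm x.
Proof.
rewrite sqnormE (bigD1 i)//= lerDl sumr_ge0// => j _; exact: sqr_ge0.
Qed.

Lemma coord_le_norm x i : `|x ord0 i| <= `|x|.
Proof.
rewrite [leRHS]/Num.norm /= mx_normrE; apply/bigmax_geP; right => /=.
by exists (ord0, i).
Qed.

Lemma norm_le_coord x (r : R) : 0 <= r -> (forall i, `|x ord0 i| <= r) -> `|x| <= r.
Proof.
move=> r0 xr; rewrite [leLHS]/Num.norm /= mx_normrE; apply/bigmax_leP.
by split=> // -[i j] _ /=; rewrite (ord1 i).
Qed.

Lemma norm_le_enorm x : `|x| <= enorm x.
Proof.
apply: norm_le_coord => [|i]; first exact: enorm_ge0.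
rewrite -(@ler_pXn2r _ 2)// ?nnegrE ?enorm_ge0// enorm_sqr.
by rewrite real_normK ?num_real// sqnorm_coord.
Qed.

Lemma sqnorm_le_norm x : sqnorm x <= d%:R * `|x| ^+ 2.
Proof.
have -> : d%:R * `|x| ^+ 2 = \sum_(i < d) `|x| ^+ 2.
  by rewrite sumr_const card_ord mulr_natl.
rewrite sqnormE; apply: ler_sum => i _.
rewrite -real_normK ?num_real//.
by rewrite ler_pXn2r ?nnegrE// coord_le_norm.
Qed.

Lemma continuous_coord i : continuous (fun x => x ord0 i : R).
Proof. exact: coord_continuous. Qed.

Lemma continuous_sqnorm : continuous sqnorm.
Proof.
apply: (@continuous_big _ _ +%R); first exact: add_continuous.
by move=> i _ x; apply: continuousM; exact: continuous_coord.
Qed.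

Lemma continuous_enorm : continuous (@enorm R d).
Proof.
move=> x; rewrite (_ : @enorm R d = Num.sqrt \o sqnorm); last first.
  by apply/funext => y /=; rewrite enormE.
apply: continuous_comp; [exact: continuous_sqnorm|exact: sqrt_continuous].
Qed.

Lemma continuous_line x n : continuous (fun t : R => x + t *: n).
Proof.
move=> t; apply: cvgD; first exact: cvg_cst.
by apply: cvgZr_tmp; exact: cvg_id.
Qed.

End euclid.

(** * Second derivatives on the line *)

Section second_derivative.
Context {R : realType}.
Implicit Types (f g p q : R -> R) (a s t l m : R).

(** The derivative [p] is only asked to exist near [t], so that a function known on a
    neighbourhood of [t] has a second derivative at [t]. *)
Definition second_derivative f (t l : R) : Prop :=
  exists p, (\forall s \near t, is_derive (s : R) 1 f (p s)) /\ is_derive t 1 p l.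

Lemma second_derivative_global f p t l : (forall s, is_derive (s : R) 1 f (p s)) ->
  is_derive t 1 p l -> second_derivative f t l.
Proof. by move=> fp pl; exists p; split => //; near=> s; exact: fp.
Unshelve. all: by end_near. Qed.

Lemma second_derivativeD f g t l m :
  second_derivative f t l -> second_derivative g t m ->
  second_derivative (fun s => f s + g s) t (l + m).
Proof.
move=> [p [fp pl]] [q [gq qm]]; exists (fun s => p s + q s); split.
  by apply: filterS2 fp gq => s ? ?; exact: is_deriveD.
exact: is_deriveD.
Qed.

Lemma second_derivativeZ (a : R) f t l :
  second_derivative f t l -> second_derivative (fun s => a * f s) t (a * l).
Proof.
move=> [p [fp pl]]; exists (fun s => a * p s); split.
  by apply: filterS fp => s ?; exact: is_deriveZ.
exact: is_deriveZ.
Qed.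

(** The first derivative vanishes at [t]; if the second one were positive, the first
    one would be positive just after [t] and [f] would increase there. *)
Lemma second_derivative_max f t l : (\forall s \near t, f s <= f t) ->
  second_derivative f t l -> l <= 0.
Proof.
move=> fmax [p [fp pl]]; rewrite leNgt; apply/negP => l0.
have [e /= e0 He] : exists2 e : R, 0 < e & forall s, `|t - s| < e ->
    is_derive (s : R) 1 f (p s) /\ f s <= f t.
  have /nbhs_ballP[e e0 He] : \forall s \near t, is_derive (s : R) 1 f (p s) /\ f s <= f t.
    by apply: filterS2 fp fmax => s.
  by exists e => // s ts; exact: He.
have pt0 : p t = 0.
  have Ht : is_derive t 1 f 0.
    apply: (@derive1_at_max _ f (t - e) (t + e) t).
    - lra.
    - move=> s; rewrite in_itv/= => /andP[s1 s2].
      have [|D _] := He s; last by case: D.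
      by rewrite ltr_norml; apply/andP; split; lra.
    - by rewrite in_itv/=; apply/andP; split; lra.
    - move=> s; rewrite in_itv/= => /andP[s1 s2].
      have [|//] := He s.
      by rewrite ltr_norml; apply/andP; split; lra.
  have [|D _] := He t; first by rewrite subrr normr0.
  by rewrite -(@derive_val _ _ _ _ _ _ _ D) (@derive_val _ _ _ _ _ _ _ Ht).
have [r /= r0 Hr] : exists2 r : R, 0 < r & forall h, 0 < h -> h < r -> 0 < p (t + h).
  have [pd pv] := pl.
  have : (fun h => h^-1 *: ((p \o shift t) (h *: 1) - p t)) @ 0^' --> l.
    by rewrite -pv; exact: pd.
  move/cvgr_gt => /(_ 0 l0); rewrite near_withinE => /nbhs_ballP[r r0 Hr].
  exists r => // h h0 hr.
  have := Hr h; rewrite /ball/= sub0r normrN gtr0_norm// => /(_ hr (lt0r_neq0 h0)).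
  rewrite pt0 subr0 /= /GRing.scale/= mulr1 addrC pmulr_rgt0// ?invr_gt0//.
pose h := Num.min e r / 2.
have m0 : 0 < Num.min e r by rewrite lt_min e0 r0.
have h0 : 0 < h by rewrite divr_gt0.
have hm : h < Num.min e r by rewrite /h; lra.
have he : h < e by rewrite (lt_le_trans hm)// ge_min lexx.
have hr : h < r by rewrite (lt_le_trans hm)// ge_min lexx orbT.
have dif s : t <= s <= t + h -> is_derive (s : R) 1 f (p s).
  move=> /andP[s1 s2]; have [|//] := He s.
  by rewrite ltr_norml; apply/andP; split; lra.
have [|||c] := @MVT _ f p t (t + h).
- by rewrite ltrDl.
- by move=> s; rewrite in_itv/= => /andP[/ltW s1 /ltW s2]; apply: dif; rewrite s1.
- apply: derivable_within_continuous => s; rewrite in_itv/= => s12.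
  by case: (dif _ s12).
rewrite in_itv/= => /andP[c1 c2] E.
have := Hr (c - t); rewrite subr_gt0 => /(_ c1).
have -> : t + (c - t) = c by lra.
have /[swap]/[apply] pc : c - t < r by lra.
have [|_] := He (t + h); first by rewrite ltr_norml; apply/andP; split; lra.
by rewrite -subr_le0 E addrC addKr leNgt mulr_gt0.
Qed.

End second_derivative.

(** * The Laplacian *)

Section laplacian.
Context {R : realType} {d : nat}.
Local Notation V := 'rV[R]_d.
Implicit Types (f g : V -> R) (x y : V).

(** A relational Laplacian: linear combinations and explicit barriers are handled
    without any differentiability bookkeeping. *)
Definition has_laplacian f x (l : R) : Prop :=
  exists q : 'I_d -> R,
    (forall i, second_derivative (fun s => f (x + s *: unit_vector R i)) 0 (q i)) /\
    l = \sum_i q i.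

Lemma has_laplacianD f g x l m : has_laplacian f x l -> has_laplacian g x m ->
  has_laplacian (fun y => f y + g y) x (l + m).
Proof.
move=> [p [fp ->]] [q [gq ->]]; exists (fun i => p i + q i); split.
  by move=> i; exact: second_derivativeD.
by rewrite big_split.
Qed.

Lemma has_laplacianZ a f x l : has_laplacian f x l ->
  has_laplacian (fun y => a * f y) x (a * l).
Proof.
move=> [p [fp ->]]; exists (fun i => a * p i); split.
  by move=> i; exact: second_derivativeZ.
by rewrite big_distrr.
Qed.

Lemma has_laplacian_max f x l : (\forall y \near x, f y <= f x) ->
  has_laplacian f x l -> l <= 0.
Proof.
move=> fx [q [fq ->]]; apply: sumr_le0 => i _.
apply: (second_derivative_max _ (fq i)).
have : (fun s : R => x + s *: unit_vector R i) @ (0 : R) --> x + 0 *: unit_vector R i.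
  exact: continuous_line.
rewrite scale0r addr0 => cx.
by have := cx _ fx; rewrite /= near_simpl.
Qed.

Lemma is_derive_line f x v t : derivable f (x + t *: v) v ->
  is_derive (t : R) 1 (fun s => f (x + s *: v)) ('D_v f (x + t *: v)).
Proof.
move=> df.
have E : (fun h : R => h^-1 *: (((fun s => f (x + s *: v)) \o shift t) (h *: 1)
      - f (x + t *: v))) =
    (fun h => h^-1 *: ((f \o shift (x + t *: v)) (h *: v) - f (x + t *: v))).
  apply/funext => h /=; congr (_ *: (f _ - _)).
  by rewrite [h%:A]mulr1 scalerDl addrCA.
by apply: DeriveDef; rewrite /derivable /derive E.
Qed.

Lemma near_line (U : set V) x v : open U -> U x ->
  \forall s \near (0 : R), U (x + s *: v).
Proof.
move=> oU Ux.
have : (fun s : R => x + s *: v) @ (0 : R) --> x + 0 *: v.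
  exact: continuous_line.
rewrite scale0r addr0 => cx.
exact: (cx _ (open_nbhs_nbhs (conj oU Ux))).
Qed.

Lemma class_C2_has_laplacian (U : set V) f x : open U -> class_C 2 U f -> U x ->
  has_laplacian f x (laplacian f x).
Proof.
move=> oU [_ C2] Ux; exists (fun i => partial i (partial i f) x); split => // i.
exists (fun s => partial i f (x + s *: unit_vector R i)); split.
  have [fd _] := C2 i.
  apply: filterS (near_line (unit_vector R i) oU Ux) => s Us.
  by apply: is_derive_line; exact: fd.
have [_ [_ /(_ i)[fd _]]] := C2 i.
have H := @is_derive_line (partial i f) x (unit_vector R i) 0.
rewrite scale0r addr0 in H; exact/H/fd.
Qed.

Lemma sqnorm_shift_line x y i s :
  sqnorm (x + s *: unit_vector R i - y) =
  sqnorm (x - y) + 2 * (x - y) ord0 i * s + s ^+ 2.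
Proof.
rewrite addrAC sqnorm_line.
have -> : sqnorm (unit_vector R i) = 1 by rewrite /sqnorm dot_unit_vector mxE !eqxx.
by rewrite dot_unit_vector mulr1; ring.
Qed.

Lemma is_derive_quadratic (a b c s : R) :
  is_derive s 1 (fun t => a + b * t + c * t ^+ 2) (b + 2 * c * s).
Proof.
apply: is_derive_eq.
by rewrite /GRing.scale/=; ring.
Qed.

Lemma has_laplacian_sqnorm x y : has_laplacian (fun z => sqnorm (z - y)) x (2 * d%:R).
Proof.
exists (fun=> 2); split; last by rewrite sumr_const card_ord mulr_natr.
move=> i; pose c := (x - y) ord0 i.
apply: (@second_derivative_global _ _ (fun s => 2 * c + 2 * 1 * s)).
  move=> s; under eq_fun do rewrite sqnorm_shift_line -[X in _ + X]mul1r.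
  exact: is_derive_quadratic.
have := @is_derive_quadratic (2 * c) (2 * 1) 0 0.
by under eq_fun do rewrite mul0r addr0; rewrite mulr0 mulr1 addr0.
Qed.

Lemma has_laplacian_gauss a x y :
  has_laplacian (fun z => expR (a * sqnorm (z - y))) x
    ((2 * a * d%:R + 4 * a ^+ 2 * sqnorm (x - y)) * expR (a * sqnorm (x - y))).
Proof.
pose c i := (x - y) ord0 i.
pose S := sqnorm (x - y).
exists (fun i => (2 * a + 4 * a ^+ 2 * c i ^+ 2) * expR (a * S)); split; last first.
  rewrite -mulr_suml big_split/= sumr_const card_ord mulr_natr.
  by rewrite -big_distrr/= [S]sqnormE.
move=> i; pose Q s := a * S + (a * (2 * c i)) * s + a * s ^+ 2.
have dQ s : is_derive (s : R) 1 Q (a * (2 * c i) + 2 * a * s).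
  exact: is_derive_quadratic.
have dE s : is_derive (s : R) 1 (expR \o Q) (expR (Q s) * (a * (2 * c i) + 2 * a * s)).
  exact: is_derive1_comp.
apply: (@second_derivative_global _ _
    (fun s => expR (Q s) * (a * (2 * c i) + 2 * a * s))).
  move=> s.
  have -> : (fun s => expR (a * sqnorm (x + s *: unit_vector R i - y))) = expR \o Q.
    apply/funext => t; rewrite sqnorm_shift_line /Q /=; congr expR.
    by rewrite -/(c i) -/S; ring.
  exact: dE.
have dL : is_derive (0 : R) 1 (fun s => a * (2 * c i) + 2 * a * s + 0 * s ^+ 2)
    (2 * a + 2 * 0 * 0).
  exact: is_derive_quadratic.
rewrite (_ : (fun s => a * (2 * c i) + 2 * a * s + 0 * s ^+ 2) =
  (fun s => a * (2 * c i) + 2 * a * s)) in dL; last first.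
  by apply/funext => s; rewrite mul0r addr0.
apply: is_derive_eq (is_deriveM (dE 0) dL) _.
rewrite /= /GRing.scale/= /Q.
rewrite (_ : a * S + a * (2 * c i) * 0 + a * 0 ^+ 2 = a * S); last by ring.
ring.
Qed.

End laplacian.

(** * Functions with continuous partial derivatives *)

Section C1_functions.
Context {R : realType} {d : nat}.
Local Notation V := 'rV[R]_d.
Implicit Types (f g : V -> R) (x y n : V) (U : set V).

Lemma line_is_derive f x v (l : R) : is_derive (0 : R) 1 (fun s => f (x + s *: v)) l ->
  is_derive x v f l.
Proof.
pose F s := f (x + s *: v); rewrite -/F => -[df dv].
have E : (fun h : R => h^-1 *: ((F \o shift 0) (h *: 1) - F 0)) =
    (fun h => h^-1 *: ((f \o shift x) (h *: v) - f x)).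
  apply/funext => h /=; rewrite /F scale0r !addr0; congr (_ *: (f _ - _)).
  by rewrite [h%:A]mulr1 addrC.
by move: df dv; rewrite /derivable /derive E => df dv; exact: DeriveDef.
Qed.

Lemma mean_value_bound (p q : R -> R) (b L eta : R) :
  (forall s : R, `|s| <= `|b| -> is_derive s 1 p (q s) /\ `|q s - L| <= eta) ->
  `|p b - p 0 - b * L| <= `|b| * eta.
Proof.
move=> H.
have cts (u v : R) : `|u| <= `|b| -> `|v| <= `|b| -> u <= v ->
    exists2 c, `|c| <= `|b| & p v - p u = q c * (v - u).
  move=> ub vb uv.
  have between s : u <= s <= v -> `|s| <= `|b|.
    move=> /andP[us sv]; rewrite ler_norml.
    by move: ub vb; rewrite !ler_norml => /andP[? ?] /andP[? ?]; apply/andP; split; lra.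
  have [//|s|s|c] := @MVT_segment _ p q u v.
  - by rewrite in_itv/= => /andP[/ltW us /ltW sv]; case: (H s) => //; apply: between; rewrite us.
  - apply: derivable_within_continuous => s'; rewrite in_itv/= => us'.
    by case: (H s' (between _ us')) => -[].
  - by rewrite in_itv/= => /between cb E; exists c.
have [b0|b0] := lerP 0 b.
  have [||//|c cb ->] := cts 0 b; rewrite ?normr0//.
  have [_] := H c cb; rewrite subr0 [b * L]mulrC -mulrBl normrM mulrC => ?.
  by rewrite ler_wpM2l.
have [||//|c cb E] := cts b 0; rewrite ?normr0 ?(ltW b0)//.
have [_] := H c cb => ?.
have -> : p b - p 0 - b * L = (q c - L) * b.
  by rewrite -[p b - p 0]opprB E; ring.
by rewrite normrM mulrC ler_wpM2l.
Qed.

(** The partial derivatives being continuous, [g] is differentiable: the increment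
    is split into increments along the coordinate axes, each of which is controlled
    by the mean value theorem. *)
Lemma class_C1_increment U g x n (e : R) : open U -> class_C 1 U g -> U x -> 0 < e ->
  \forall t \near (0 : R), `|g (x + t *: n) - g x - t * dot (gradient g x) n| <= e * `|t|.
Proof.
move=> oU [_ C1] Ux e0.
pose eta := e / (d%:R * `|n| + 1).
have dn0 : 0 < d%:R * `|n| + 1 by rewrite ltr_wpDl// mulr_ge0.
have eta0 : 0 < eta by rewrite divr_gt0.
have nearU : \forall y \near x, U y /\
    forall i, `|partial i g y - partial i g x| <= eta.
  near=> y; split; first by near: y; exact: open_nbhs_nbhs.
  near: y; apply: filter_forall => i.
  have [_ [ci _]] := C1 i.
  have /cvgrPdist_le/(_ _ eta0) := ci x Ux.
  by apply: filterS => y; rewrite distrC.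
have /nbhs_ballP[r /= r0 Hr] := nearU.
have {nearU}nearU y : `|y - x| < r -> U y /\
    forall i, `|partial i g y - partial i g x| <= eta.
  by move=> yx; apply: Hr; rewrite -ball_normE /= distrC.
near=> t.
have tr : `|t| * `|n| < r.
  rewrite (@le_lt_trans _ _ (`|t| * (`|n| + 1)))//.
    by rewrite ler_wpM2l// lerDl.
  rewrite -ltr_pdivlMr ?ltr_wpDl//; near: t.
  apply: (@nbhs0_lt _ R); first by rewrite divr_gt0// ltr_wpDl.
(* [x + t *: trunc j] is the path from [x] to [x + t *: n] along the axes. *)
pose trunc j : V := \row_i (if (i < j)%N then n ord0 i else 0).
have step j : (j <= d)%N ->
    `|g (x + t *: trunc j) - g x - t * dot (gradient g x) (trunc j)|
      <= j%:R * (`|t| * `|n| * eta).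
  elim: j => [_|j IH jd].
    have -> : trunc 0%N = 0 by apply/rowP => i; rewrite !mxE.
    have -> : dot (gradient g x) 0 = 0 by rewrite -(scale0r 0) dotZr mul0r.
    by rewrite scaler0 addr0 subrr mulr0 subr0 normr0 mul0r.
  pose i := Ordinal jd; pose z := x + t *: trunc j.
  have truncS : trunc j.+1 = trunc j + n ord0 i *: unit_vector R i.
    apply/rowP => k; rewrite !mxE !eqxx/= ltnS.
    have -> : (k == i) = (k == j :> nat) by [].
    case: ltngtP => kj; rewrite ?mulr0 ?addr0// mulr1 add0r.
    by congr (n ord0 _); exact: val_inj.
  have zE s : `|s| <= `|t * n ord0 i| -> `|z + s *: unit_vector R i - x| < r.
    move=> sb; rewrite (le_lt_trans _ tr)//.
    apply: norm_le_coord => [|k]; first by rewrite mulr_ge0.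
    rewrite /z addrAC [x + _]addrC addrK !mxE eqxx/=.
    have [->|ki] := eqVneq k i.
      rewrite ltnn mulr0 add0r mulr1 (le_trans sb)// normrM ler_wpM2l//.
      exact: coord_le_norm.
    rewrite mulr0 addr0; case: ifP => _; last by rewrite mulr0 normr0 mulr_ge0.
    by rewrite normrM ler_wpM2l// coord_le_norm.
  have := @mean_value_bound (fun s => g (z + s *: unit_vector R i))
    (fun s => partial i g (z + s *: unit_vector R i)) (t * n ord0 i)
    (partial i g x) eta.
  have /[swap]/[apply] : forall s : R, `|s| <= `|t * n ord0 i| ->
     is_derive s 1 (fun s => g (z + s *: unit_vector R i))
        (partial i g (z + s *: unit_vector R i)) /\
     `|partial i g (z + s *: unit_vector R i) - partial i g x| <= eta.
    move=> s /zE /nearU[Uz Hz]; split; last exact: Hz.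
    by apply: is_derive_line; case: (C1 i) => + _; exact.
  rewrite scale0r addr0 => Hi.
  have -> : x + t *: trunc j.+1 = z + (t * n ord0 i) *: unit_vector R i.
    by rewrite truncS scalerDr scalerA addrA.
  rewrite truncS dotDr dotZr dot_unit_vector mxE.
  rewrite -natr1 mulrDl mul1r.
  set A := g _; set B := g z in IH Hi; set T := dot _ _ in IH *.
  have -> : A - g x - t * (T + n ord0 i * partial i g x) =
    (B - g x - t * T) + (A - B - t * n ord0 i * partial i g x) by ring.
  apply: (le_trans (ler_normD _ _)); apply: lerD; first exact/IH/ltnW.
  apply: (le_trans Hi); rewrite ler_wpM2r ?(ltW eta0)// normrM ler_wpM2l//.
  exact: coord_le_norm.
have := step d (leqnn d).
have -> : trunc d = n by apply/rowP => i; rewrite !mxE ltn_ord.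
move=> /le_trans; apply.
rewrite [e * _]mulrC /eta.
have -> : d%:R * (`|t| * `|n| * (e / (d%:R * `|n| + 1))) =
  `|t| * (e * (d%:R * `|n| / (d%:R * `|n| + 1))) by ring.
rewrite ler_wpM2l// ler_piMr ?(ltW e0)//.
by rewrite ler_pdivrMr// mul1r lerDl.
Unshelve. all: by end_near. Qed.

Lemma is_derive_coord x v (a : R) i :
  is_derive x v (fun y : V => a * y ord0 i) (a * v ord0 i).
Proof.
apply: line_is_derive.
have := @is_derive_quadratic _ (a * x ord0 i) (a * v ord0 i) 0 0.
rewrite mulr0 addr0 (_ : (fun t => _) = (fun s => a * (x + s *: v) ord0 i))//.
by apply/funext => s; rewrite !mxE; ring.
Qed.

Lemma is_derive_sqnorm x v (c : R) :
  is_derive x v (fun y : V => sqnorm y - c) (2 * dot x v).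
Proof.
apply: line_is_derive.
have := @is_derive_quadratic _ (sqnorm x - c) (2 * dot x v) (sqnorm v) 0.
rewrite mulr0 addr0 (_ : (fun t => _) = (fun s => sqnorm (x + s *: v) - c))//.
by apply/funext => s; rewrite sqnorm_line; ring.
Qed.

Lemma class_C_cst k U (c : R) : class_C k U (fun=> c).
Proof.
have cc (a : R) x : U x -> {for x, continuous (fun=> a : R)}.
  by move=> _; exact: cst_continuous.
elim: k c => [|k IH] c; split => //; try exact: cc.
move=> i; split; first by move=> x _; exact: (derivable_cst c).
rewrite (_ : partial i _ = fun=> 0)//.
by apply/funext => x; exact: (derive_cst c).
Qed.

Lemma class_C_coord k U (a : R) i : class_C k U (fun y => a * y ord0 i).
Proof.
have ca : forall x, U x -> {for x, continuous (fun y : V => a * y ord0 i)}.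
  move=> x _; apply: continuousM; first exact: cst_continuous.
  exact: continuous_coord.
case: k => [|k]; split => // j; split.
  by move=> x _; have [] := is_derive_coord x (unit_vector R j) a i.
rewrite (_ : partial j _ = fun=> a * (unit_vector R j) ord0 i); first exact: class_C_cst.
by apply/funext => x; have [] := is_derive_coord x (unit_vector R j) a i.
Qed.

Lemma partial_sqnorm i (c : R) :
  partial i (fun y : V => sqnorm y - c) = fun y => 2 * y ord0 i.
Proof.
apply/funext => x; have [_] := is_derive_sqnorm x (unit_vector R i) c.
by rewrite dot_unit_vector.
Qed.

Lemma smooth_sqnorm U (c : R) : smooth_on U (fun y => sqnorm y - c).
Proof.
have cs x : U x -> {for x, continuous (fun y : V => sqnorm y - c)}.
  by move=> _; apply: continuousB; [exact: continuous_sqnorm|exact: cst_continuous].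
case=> [|k]; split => // i; split.
  by move=> x _; have [] := is_derive_sqnorm x (unit_vector R i) c.
by rewrite partial_sqnorm; exact: class_C_coord.
Qed.

Lemma gradient_sqnorm x (c : R) : gradient (fun y => sqnorm y - c) x = 2 *: x.
Proof. by apply/rowP => i; rewrite !mxE partial_sqnorm. Qed.

End C1_functions.

(** * Subsolutions and Gaussian barriers *)

Section sinh_bound.
Context {R : realType}.
Implicit Types u v : R.

(** With [h] half the difference and [m] the mean of [u] and [v], the right-hand side is
    the product of [expR m + expR (- m) >= 2] and [expR h - expR (- h) >= h]. *)
Lemma sinh_growth u v : v <= u ->
  u - v <= (expR u - expR (- u)) - (expR v - expR (- v)).
Proof.
move=> vu; pose h := (u - v) / 2; pose m := (u + v) / 2.
have -> : u = m + h by rewrite /m /h; lra.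
have -> : v = m - h by rewrite /m /h; lra.
have h0 : 0 <= h by rewrite /h; lra.
rewrite !opprD !opprK !expRD.
have hh : h <= expR h - expR (- h).
  have : expR (- h) <= 1 by rewrite -[leRHS]expR0 ler_expR oppr_le0.
  have := expR_ge1Dx h; lra.
have mm : 2 <= expR m + expR (- m).
  by have := expR_ge1Dx m; have := expR_ge1Dx (- m); lra.
have := ler_pM h0 (ler0n _ 2) hh mm; lra.
Qed.

End sinh_bound.

Section comparison.
Context {R : realType} {d : nat}.
Local Notation V := 'rV[R]_d.
Implicit Types (f g u : V -> R) (x y n : V) (U D : set V) (k : R).

Definition sinh_solution k D f : Prop :=
  forall x, D x -> has_laplacian f x (k * (expR (f x) - expR (- f x))).

(** Only the part where [u] is positive matters: this is all that a bound from above
    by a nonnegative constant or barrier needs. *)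
Definition subsolution k D u : Prop :=
  forall x, D x -> 0 < u x -> exists2 l, has_laplacian u x l & k * u x <= l.

Lemma sinh_solution0 k D : sinh_solution k D (fun=> 0).
Proof.
move=> x _; rewrite oppr0 subrr mulr0.
have := has_laplacianZ 0 (has_laplacian_sqnorm x 0).
by under eq_fun do rewrite mul0r; rewrite mul0r.
Qed.

Lemma poisson_boltzmann_sinh nu rho D f : 0 < nu -> open D -> class_C 2 D f ->
  poisson_boltzmann nu rho D f -> sinh_solution (rho / nu) D f.
Proof.
move=> nu0 oD C2 PB x Dx.
suff <- : laplacian f x = rho / nu * (expR (f x) - expR (- f x)).
  exact: class_C2_has_laplacian C2 Dx.
have := PB x Dx; set l := laplacian f x => E.
have nu1 : nu != 0 by rewrite gt_eqF.
apply: (mulfI nu1); rewrite -[LHS]opprK -mulNr E; field.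
exact: nu1.
Qed.

Lemma subsolutionB k D f g : 0 < k -> sinh_solution k D f -> sinh_solution k D g ->
  subsolution k D (fun x => f x - g x).
Proof.
move=> k0 fs gs x Dx; rewrite subr_gt0 => /ltW fg.
exists (k * (expR (f x) - expR (- f x)) + (-1) * (k * (expR (g x) - expR (- g x)))).
  under eq_fun do rewrite -[- g _]mulN1r.
  by apply: has_laplacianD; [exact: fs|exact/has_laplacianZ/gs].
rewrite mulN1r -mulrBr ler_wpM2l ?(ltW k0)//.
exact: sinh_growth.
Qed.

Lemma is_derive_quotient (p : R -> R) (l : R) : is_derive (0 : R) 1 p l ->
  (fun t => t^-1 * (p t - p 0)) @ 0^' --> l.
Proof.
move=> [pd pv]; rewrite -pv.
have E : (fun t => t^-1 * (p t - p 0)) =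
    (fun h => h^-1 *: ((p \o shift 0) (h *: 1) - p 0)).
  by apply/funext => h /=; rewrite addr0 [h%:A]mulr1.
by rewrite E; exact: pd.
Qed.

Lemma continuous_sqdist y : continuous (fun x : V => sqnorm (x - y)).
Proof.
move=> x; apply: (@continuous_comp _ _ _ (fun x => x - y)).
  by apply: continuousB; [exact: cvg_id|exact: cst_continuous].
exact: continuous_sqnorm.
Qed.

Lemma continuous_gauss (B a : R) y :
  continuous (fun x : V => B * expR (a * sqnorm (x - y))).
Proof.
move=> x; apply: (@continuousM R V (fun=> B)); first exact: cst_continuous.
apply: (@continuous_comp _ _ _ (fun x => a * sqnorm (x - y))); last exact: continuous_expR.
apply: (@continuousM R V (fun=> a)); first exact: cst_continuous.
exact: continuous_sqdist.
Qed.

Lemma is_derive_gauss_line (B a : R) x y n :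
  is_derive (0 : R) 1 (fun t => B * expR (a * sqnorm (x + t *: n - y)))
    (B * expR (a * sqnorm (x - y)) * (a * (2 * dot (x - y) n))).
Proof.
pose Q t := a * sqnorm (x - y) + a * (2 * dot (x - y) n) * t + a * sqnorm n * t ^+ 2.
have dQ : is_derive (0 : R) 1 Q (a * (2 * dot (x - y) n) + 2 * (a * sqnorm n) * 0).
  exact: is_derive_quadratic.
rewrite (_ : (fun t => _) = (fun t => B * (expR \o Q) t)); last first.
  apply/funext => t /=; rewrite /Q addrAC sqnorm_line; congr (_ * expR _); ring.
apply: is_derive_eq.
by rewrite /GRing.scale/= /Q; rewrite mulr0 addr0 expr0n/= !mulr0 !addr0; ring.
Qed.

Lemma dnbhs_at_left : (0 : R)^'- `=>` (0 : R)^'.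
Proof.
move=> P; rewrite /dnbhs /at_left /= /within /=.
by apply: filterS => t + t0; apply; rewrite lt_eqF.
Qed.

Lemma dnbhs_at_right : (0 : R)^'+ `=>` (0 : R)^'.
Proof.
move=> P; rewrite /dnbhs /at_right /= /within /=.
by apply: filterS => t + t0; apply; rewrite gt_eqF.
Qed.

Lemma compact_closure_ball D y (r : R) : 0 <= r ->
  compact (closure D `&` [set x | sqnorm (x - y) <= r ^+ 2]).
Proof.
move=> r0; apply: bounded_closed_compact; last first.
  apply: closedI; first exact: closed_closure.
  by apply: (@closed_comp _ _ _ [set s | s <= r ^+ 2]); [move=> *; exact: continuous_sqdist|exact: closed_le].
exists (`|y| + r); split; first exact: num_real.
move=> M yM x [_ /= xy]; rewrite (le_trans _ (ltW yM))//.
rewrite -[x](subrK y) (le_trans (ler_normD _ _))// addrC lerD2l.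
by rewrite (le_trans (norm_le_enorm _))// enorm_le.
Qed.

Lemma within_closure_ballS D (u : V -> R) y (r : R) : {within closure D, continuous u} ->
  {within closure D `&` [set x | sqnorm (x - y) <= r ^+ 2], continuous u}.
Proof. by apply: continuous_subspaceW => x []. Qed.

(** A subsolution bounded by [A] is exponentially small in the middle of a ball.  It
    is compared with the barrier [A * expR (- c * rho + (c / rho) * |x - y|^2)], whose
    Laplacian is at most [k] times itself while [|x - y| <= rho]; it equals [A] when
    [|x - y| = rho], increases in the directions pointing away from [y], and equals
    [A * expR (- c * rho)] at [y].  Hence the difference has no positive maximum, not
    even at a boundary point where [u] has zero derivative in such a direction; for a
    ball cut by a sphere, convexity makes the outward normal point away from [y]. *)
Lemma gauss_decay k D u y (A c rho : R) :
  0 < k -> open D -> subsolution k D u -> {within closure D, continuous u} ->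
  0 < A -> (forall x, closure D x -> u x <= A) -> 0 < c -> 0 < rho ->
  2 * c / rho * d%:R + 4 * c ^+ 2 <= k -> D y ->
  (forall x, closure D x -> ~ D x -> sqnorm (x - y) < rho ^+ 2 ->
    exists n, [/\ 0 < dot (x - y) n, \forall t \near (0 : R)^'-, D (x + t *: n) &
      (fun t : R => t^-1 * (u (x + t *: n) - u x)) @ (0 : R)^'- --> (0 : R)]) ->
  u y <= A * expR (- c * rho).
Proof.
move=> k0 oD su cu A0 uA c0 rho0 ck Dy Dn.
pose a := c / rho; pose B := A * expR (- c * rho).
have a0 : 0 < a by rewrite divr_gt0.
have B0 : 0 < B by rewrite mulr_gt0// expR_gt0.
pose b x := B * expR (a * sqnorm (x - y)).
have cb : continuous b by exact: continuous_gauss.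
pose K := closure D `&` [set x | sqnorm (x - y) <= rho ^+ 2].
have Ky : K y.
  split; first exact: subset_closure.
  by rewrite /= subrr sqnorm0 sqr_ge0.
have [|||z] := @compact_EVT_max _ _ (fun x => u x - b x) K.
- by exists y.
- exact: compact_closure_ball (ltW rho0).
- move=> x; apply: (@continuousB _ _ (subspace K)); first exact: within_closure_ballS.
  exact: continuous_subspaceT.
rewrite inE => -[Dz zr] zmax.
suff vz : u z - b z <= 0.
  have : u y - b y <= 0 by rewrite (le_trans _ vz)//; apply: zmax; rewrite inE.
  rewrite subr_le0 /b subrr sqnorm0 mulr0 expR0 mulr1//.
rewrite leNgt; apply/negP => vz.
have bz0 : 0 < b z by rewrite mulr_gt0// expR_gt0.
(* on the sphere [|z - y| = rho], the barrier equals [A] *)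
have {}zr : sqnorm (z - y) < rho ^+ 2.
  rewrite lt_neqAle zr andbT; apply/eqP => E.
  move: vz; rewrite /b E /B -mulrA -expRD.
  have -> : - c * rho + a * rho ^+ 2 = 0.
    by rewrite /a; field; rewrite gt_eqF.
  by rewrite expR0 mulr1 subr_gt0 ltNge uA.
have ball_near : \forall x \near z, sqnorm (x - y) < rho ^+ 2.
  exact: (cvgr_lt (sqnorm (z - y)) (@continuous_sqdist y z)).
have [Dz'|Dz'] := pselect (D z).
  have [l lu kl] : exists2 l, has_laplacian u z l & k * u z <= l.
    by apply: su => //; rewrite (lt_trans bz0)// -subr_gt0.
  have /has_laplacian_max H :=
    has_laplacianD lu (has_laplacianZ (- B) (has_laplacian_gauss a z y)).
  have {H}/H : \forall x \near z, u x + - B * expR (a * sqnorm (x - y)) <=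
      u z + - B * expR (a * sqnorm (z - y)).
    have Dnear : \forall x \near z, D x by exact: open_nbhs_nbhs.
    apply: filterS2 Dnear ball_near => x Dx /ltW xr.
    rewrite !mulNr; apply: zmax; rewrite inE; split => //; exact: subset_closure.
  apply/negP; rewrite -ltNge mulNr subr_gt0 (lt_le_trans _ kl)//.
  rewrite mulrCA -/(b z).
  apply: (@le_lt_trans _ _ (k * b z)); last first.
    by rewrite ltr_pM2l// -subr_gt0.
  rewrite ler_wpM2r ?(ltW bz0)// (le_trans _ ck)// -[2 * c / rho]mulrA -/a lerD2l.
  rewrite -mulrA ler_wpM2l// (le_trans (ler_wpM2l _ (ltW zr))) ?sqr_ge0//.
  by rewrite /a expr_div_n divfK// expf_neq0// gt_eqF.
have [n [zn nD un]] := Dn z Dz Dz' zr.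
pose beta := b z * (a * (2 * dot (z - y) n)).
have beta0 : 0 < beta by rewrite mulr_gt0// mulr_gt0// mulr_gt0.
have bn : (fun t : R => t^-1 * (b (z + t *: n) - b z)) @ (0 : R)^'- --> beta.
  have := is_derive_quotient (is_derive_gauss_line B a z y n).
  rewrite scale0r addr0 -/(b z) -/beta => H.
  by apply: cvg_trans H; apply: cvg_app; exact: dnbhs_at_left.
have balln : \forall t \near (0 : R)^'-, sqnorm (z + t *: n - y) < rho ^+ 2.
  apply: cvg_within; have := @continuous_line _ _ z n 0.
  by rewrite /continuous_at scale0r addr0 => /(_ _ ball_near).
near (0 : R)^'- => t.
have t0 : t < 0 by near: t; exact: nbhs_left_lt.
have ub : u (z + t *: n) - u z <= b (z + t *: n) - b z.
  suff : u (z + t *: n) - b (z + t *: n) <= u z - b z by lra.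
  apply: zmax; rewrite inE; split; last by apply: ltW; near: t.
  by apply: subset_closure; near: t.
have qu : t^-1 * (u (z + t *: n) - u z) < beta / 2.
  by near: t; apply: (cvgr_lt _ un); rewrite divr_gt0.
have qb : beta / 2 < t^-1 * (b (z + t *: n) - b z).
  by near: t; apply: (cvgr_gt _ bn); lra.
have := lt_trans qu qb; rewrite ltr_nM2l ?invr_lt0// => /lt_le_trans/(_ ub).
by rewrite ltxx.
Unshelve. all: by end_near. Qed.


End comparison.

(** * Hopf lemma and maximum principle *)

Section maximum_principle.
Context {R : realType} {d : nat}.
Local Notation V := 'rV[R]_d.
Implicit Types (f g u : V -> R) (x y n : V) (U D : set V) (k : R).

Lemma class_C2_class_C1 U f : class_C 2 U f -> class_C 1 U f.
Proof.
move=> [cf df]; split => // i; have [di [ci _]] := df i.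
by split => //; split.
Qed.

Lemma class_C2_laplacian_continuous U f x : class_C 2 U f -> U x ->
  {for x, continuous (laplacian f)}.
Proof.
move=> [_ df] Ux; apply: (@cvg_big _ _ +%R 0 xpredT _ V (nbhs x) _
  (fun i => partial i (partial i f)) _ (nbhs_filter x)); first exact: add_continuous.
by move=> i _; have [_ [_ /(_ i)[_ [+ _]]]] := df i; exact.
Qed.

(** At a boundary point where a positive maximum is reached, the derivative along the
    inner normal cannot vanish.  Near [x] the Laplacian of [u] is at least [k * m / 2],
    where [m = u x]; thus [v = u + eps * g - eta * |y - x|^2], with [g] the function
    whose zero set is the boundary, still has a positive Laplacian for small [eps] and
    [eta].  Its maximum over a small piece of the domain lies on the boundary,
    where [g <= 0], or at distance [r] from [x], where the quadratic term beats
    [eps * g]; so it is [m], reached at [x].  Along the normal, [u] then decreases at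
    least as fast as [eps * g] increases, up to a quadratic term. *)
Lemma hopf k D u U g x n :
  0 < k -> open D -> subsolution k D u -> {within closure D, continuous u} ->
  closure D x -> 0 < u x -> (forall y, closure D y -> u y <= u x) ->
  open U -> U x -> class_C 2 U g -> g x = 0 ->
  (forall y, U y -> closure D y -> ~ D y -> g y <= 0) ->
  0 < dot (gradient g x) n ->
  (\forall t \near (0 : R)^'+, D (x + t *: n)) ->
  ~ (fun t : R => t^-1 * (u (x + t *: n) - u x)) @ (0 : R)^'+ --> (0 : R).
Proof.
move=> k0 oD su cu Dx; set m := u x => m0 um oU Ux C2 gx0 gD; set mu := dot _ _ => mu0 nD un.
pose G := `|laplacian g x| + 1.
have G0 : 0 < G by rewrite ltr_wpDl.
have [r r0 Hr] : exists2 r : R, 0 < r & forall y, sqnorm (y - x) <= r ^+ 2 ->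
    [/\ U y, g y <= 1, `|laplacian g y| <= G & closure D y -> m / 2 < u y].
  have : \forall y \near x, [/\ U y, g y <= 1, `|laplacian g y| <= G &
      closure D y -> m / 2 < u y].
    near=> y; split.
    - by near: y; exact: open_nbhs_nbhs.
    - near: y; apply: (cvgr_le (g x)); last by rewrite gx0.
      by case: C2 => + _; exact.
    - near: y; apply: (cvgr_le `|laplacian g x|); last by rewrite /G ltrDl.
      apply: cvg_norm; exact: class_C2_laplacian_continuous C2 Ux.
    - near: y; have /subspace_continuousP/(_ x Dx)/(cvgr_gt (u x))/(_ (m / 2)) := cu.
      by rewrite near_withinE; apply; rewrite -/m; lra.
  move=> /nbhs_ballP[r /= r0 Hr]; exists (r / 2); first by rewrite divr_gt0.
  move=> y; rewrite -enorm_le ?divr_ge0 ?(ltW r0)// => yr.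
  apply: Hr; rewrite -ball_normE /= distrC.
  by rewrite (le_lt_trans (norm_le_enorm _))// (le_lt_trans yr)//; lra.
have d1 : 0 < d.+1%:R :> R by [].
(* [d.+1] rather than [d], in order to divide by a positive number *)
pose eta := k * m / (16 * d.+1%:R).
have eta0 : 0 < eta by rewrite divr_gt0 ?mulr_gt0.
have km : 0 < k * m by rewrite mulr_gt0.
have etad : 2 * d%:R * eta <= k * m / 8.
  have -> : k * m / 8 = 2 * d.+1%:R * eta by rewrite /eta; field; rewrite gt_eqF.
  by rewrite ler_wpM2r ?(ltW eta0)// ler_wpM2l// ler_nat.
pose eps := Num.min (eta * r ^+ 2) (k * m / (8 * G)).
have eps0 : 0 < eps by rewrite lt_min mulr_gt0 ?exprn_gt0//= divr_gt0 ?mulr_gt0.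
have eps1 : eps <= eta * r ^+ 2 by rewrite ge_min lexx.
have epsG : eps * G <= k * m / 8.
  have : eps <= k * m / (8 * G) by rewrite ge_min lexx orbT.
  by rewrite invfM mulrA ler_pdivlMr.
pose v y := u y + (eps * g y + (- eta) * sqnorm (y - x)).
pose K := closure D `&` [set y | sqnorm (y - x) <= r ^+ 2].
have Kx : K x by split => //=; rewrite subrr sqnorm0 sqr_ge0.
have [|||z] := @compact_EVT_max _ _ v K.
- by exists x.
- exact: compact_closure_ball (ltW r0).
- move=> y; apply: (@continuousD _ _ (subspace K)); first exact: within_closure_ballS.
  move: y; apply: continuous_in_subspaceT => y; rewrite inE => -[_ /Hr[Uy _ _ _]].
  apply: (@continuousD R R V (fun y => eps * g y)).
    apply: (@continuousM R V (fun=> eps)); first exact: cst_continuous.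
    by case: C2 => + _; exact.
  apply: (@continuousM R V (fun=> - eta)); first exact: cst_continuous.
  exact: continuous_sqdist.
rewrite inE => -[Dz zr] zmax.
have vz : v z <= m.
  have [Uz gz Lz uz] := Hr z zr.
  have uzm := um z Dz.
  have sz := sqnorm_ge0 (z - x).
  have [zr'|zr'] := ltrP (sqnorm (z - x)) (r ^+ 2); last first.
    have : eps * g z <= eps * 1 by rewrite ler_wpM2l// ltW.
    have : eta * r ^+ 2 <= eta * sqnorm (z - x) by rewrite ler_wpM2l// ltW.
    by rewrite /v; lra.
  have [Dz'|Dz'] := pselect (D z); last first.
    have : eps * g z <= 0 by rewrite pmulr_rle0// gD.
    have : 0 <= eta * sqnorm (z - x) by rewrite mulr_ge0// ltW.
    by rewrite /v; lra.
  have {}uz := uz Dz.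
  have [l lu kl] : exists2 l, has_laplacian u z l & k * u z <= l.
    by apply: su => //; rewrite (lt_trans _ uz)// divr_gt0.
  have lv := has_laplacianD lu (has_laplacianD
    (has_laplacianZ eps (class_C2_has_laplacian oU C2 Uz))
    (has_laplacianZ (- eta) (has_laplacian_sqnorm z x))).
  suff : l + (eps * laplacian g z + - eta * (2 * d%:R)) <= 0.
    have : k * (m / 2) < k * u z by rewrite ltr_pM2l.
    have : - (eps * G) <= eps * laplacian g z.
      by rewrite -mulrN ler_wpM2l ?(ltW eps0)//; move: Lz; rewrite ler_norml => /andP[].
    lra.
  apply: has_laplacian_max lv.
  have Dnear : \forall y \near z, D y by exact: open_nbhs_nbhs.
  have ball_near : \forall y \near z, sqnorm (y - x) < r ^+ 2.
    exact: (cvgr_lt (sqnorm (z - x)) (@continuous_sqdist _ _ x z)).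
  apply: filterS2 Dnear ball_near => y Dy /ltW yr.
  by apply: zmax; rewrite inE; split => //; exact: subset_closure.
pose c := eps * mu / 8.
have c0 : 0 < c by rewrite divr_gt0// mulr_gt0.
have nn : 0 < eta * sqnorm n + 1 by rewrite ltr_wpDl// mulr_ge0 ?sqnorm_ge0// ltW.
have mu2 : 0 < mu / 2 by rewrite divr_gt0.
have gn : \forall t \near (0 : R)^'+, `|g (x + t *: n) - g x - t * mu| <= mu / 2 * `|t|.
  apply: cvg_within; exact: class_C1_increment (class_C2_class_C1 C2) Ux mu2.
have tn : \forall t \near (0 : R)^'+, sqnorm (x + t *: n - x) < r ^+ 2.
  have ball_near : \forall y \near x, sqnorm (y - x) < r ^+ 2.
    apply: (cvgr_lt (sqnorm (x - x)) (@continuous_sqdist _ _ x x)).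
    by rewrite subrr sqnorm0 exprn_gt0.
  apply: cvg_within; have := @continuous_line _ _ x n 0.
  by rewrite /continuous_at scale0r addr0 => /(_ _ ball_near).
near (0 : R)^'+ => t.
have t0 : 0 < t by near: t; exact: nbhs_right_gt.
have uv : v (x + t *: n) <= m.
  apply: le_trans vz; apply: zmax; rewrite inE; split.
    by apply: subset_closure; near: t.
  by apply: ltW; near: t.
have gt : t * (mu / 2) <= g (x + t *: n).
  have : `|g (x + t *: n) - g x - t * mu| <= mu / 2 * `|t| by near: t.
  by rewrite gx0 (gtr0_norm t0) ler_norml => /andP[+ _]; lra.
have qu : - c < t^-1 * (u (x + t *: n) - m).
  by near: t; apply: (cvgr_gt _ un); rewrite oppr_lt0.
have tc : eta * sqnorm n * t <= c.
  have : t <= c / (eta * sqnorm n + 1) by near: t; apply: nbhs_right_le; rewrite divr_gt0.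
  by rewrite ler_pdivlMr// => /(le_trans _); apply; rewrite mulrC ler_wpM2l ?(ltW t0)// lerDl.
move: uv; rewrite /v (_ : x + t *: n - x = t *: n); last by rewrite addrC addKr.
have -> : sqnorm (t *: n) = t ^+ 2 * sqnorm n by rewrite /sqnorm dotZl dotZr; ring.
move: qu; rewrite mulrC ltr_pdivlMr// => qu.
have : eps * (t * (mu / 2)) <= eps * g (x + t *: n) by rewrite ler_wpM2l// ltW.
have : t * (eta * sqnorm n * t) <= t * c by rewrite ler_wpM2l// ltW.
have : 0 < t * c by rewrite mulr_gt0.
have -> : eps * (t * (mu / 2)) = 4 * (t * c) by rewrite /c; field.
have -> : - eta * (t ^+ 2 * sqnorm n) = - (t * (eta * sqnorm n * t)) by ring.
lra.
Unshelve. all: by end_near. Qed.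

(** The boundary points at which [hopf] forbids a positive maximum: the boundary is
    locally the zero set of [g], and [u] has zero derivative along [n]. *)
Definition insulated D u x : Prop := exists U g n,
  [/\ open U, U x, class_C 2 U g & g x = 0] /\
  [/\ (forall y, U y -> closure D y -> ~ D y -> g y <= 0),
      0 < dot (gradient g x) n,
      \forall t \near (0 : R)^'+, D (x + t *: n) &
      (fun t : R => t^-1 * (u (x + t *: n) - u x)) @ (0 : R)^'+ --> (0 : R)].

Lemma maximum_principle k D u (B : R) : 0 < k -> open D -> compact (closure D) ->
  subsolution k D u -> {within closure D, continuous u} -> 0 <= B ->
  (forall x, closure D x -> ~ D x -> u x <= B \/ insulated D u x) ->
  forall x, closure D x -> u x <= B.
Proof.
move=> k0 oD cD su cu B0 bD x Dx.
have cD0 : closure D !=set0 by exists x.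
have [z] := compact_EVT_max cD0 cD cu.
rewrite inE => Dz zmax.
suff : u z <= B by apply: le_trans; apply: zmax; rewrite inE.
rewrite leNgt; apply/negP => Bz.
have z0 : 0 < u z by rewrite (le_lt_trans B0).
have {}zmax y : closure D y -> u y <= u z by move=> Dy; apply: zmax; rewrite inE.
have [Dz'|Dz'] := pselect (D z); last first.
  have [|[U [g [n [[oU Uz C2 gz] [gD gn nD un]]]]]] := bD z Dz Dz'.
    by rewrite leNgt Bz.
  exact: (hopf k0 oD su cu Dz z0 zmax oU Uz C2 gz gD gn nD un).
have [l lu kl] := su z Dz' z0.
have := has_laplacian_max _ lu; apply/not_implyP; split.
  have Dnear : \forall y \near z, D y by exact: open_nbhs_nbhs.
  by apply: filterS Dnear => y Dy; apply: zmax; exact: subset_closure.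
by apply/negP; rewrite -ltNge (lt_le_trans _ kl)// mulr_gt0.
Qed.

End maximum_principle.

(** * The exterior and truncated domains *)

Section domains.
Context {R : realType} {d : nat}.
Local Notation V := 'rV[R]_d.
Implicit Types (f g u : V -> R) (x y n : V) (U D C : set V) (L : R).

Lemma near_at_left_line U x n : open U -> U x ->
  \forall t \near (0 : R)^'-, U (x + t *: n).
Proof. by move=> oU Ux; apply: cvg_within; exact: near_line. Qed.

Lemma near_at_right_line U x n : open U -> U x ->
  \forall t \near (0 : R)^'+, U (x + t *: n).
Proof. by move=> oU Ux; apply: cvg_within; exact: near_line. Qed.

Lemma normal_derivative_right U f x n df : is_normal_derivative U f x n df ->
  (\forall t \near (0 : R)^'+, U (x + t *: n)) ->
  (fun t : R => t^-1 * (f (x + t *: n) - f x)) @ (0 : R)^'+ --> df.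
Proof.
move=> H HU; apply: cvg_trans H; apply: cvg_app => P.
rewrite /within /= near_simpl => /dnbhs_at_right HP.
by apply: filterS2 HP HU => t; exact.
Qed.

Lemma normal_derivative_left U f x n df : is_normal_derivative U f x n df ->
  (\forall t \near (0 : R)^'-, U (x + t *: n)) ->
  (fun t : R => t^-1 * (f (x + t *: n) - f x)) @ (0 : R)^'- --> df.
Proof.
move=> H HU; apply: cvg_trans H; apply: cvg_app => P.
rewrite /within /= near_simpl => /dnbhs_at_left HP.
by apply: filterS2 HP HU => t; exact.
Qed.

Lemma open_eball L : open (@eball R d L).
Proof.
apply: (@open_comp _ _ (@enorm R d) [set r | r < L]); last exact: open_lt.
by move=> x _; exact: continuous_enorm.
Qed.

Lemma open_Omega C : open (Omega C).
Proof. exact/closed_openC/closed_closure. Qed.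

Lemma open_Omega_ C L : open (Omega_ C L).
Proof. by apply: openI; [exact: open_eball|exact: open_Omega]. Qed.

Lemma closure_Omega_enorm C L x : closure (Omega_ C L) x -> enorm x <= L.
Proof.
have cl : closed [set y : V | enorm y <= L].
  apply: (@closed_comp _ _ (@enorm R d) [set r | r <= L]); last exact: closed_le.
  by move=> y _; exact: continuous_enorm.
move=> Dx; suff : closure [set y : V | enorm y <= L] x by rewrite -(closure_id _).1.
by apply: closure_subset Dx => y [/ltW].
Qed.

Lemma compact_closure_Omega_ C L : 0 <= L -> compact (closure (Omega_ C L)).
Proof.
move=> L0; suff -> : closure (Omega_ C L) =
    closure (Omega_ C L) `&` [set x | sqnorm (x - 0) <= L ^+ 2].
  exact: compact_closure_ball.
apply/seteqP; split => [x Dx|x []//]; split => //=.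
by rewrite subr0 -enorm_le//; exact: closure_Omega_enorm Dx.
Qed.

Lemma closure_Omega_notin C x : open C -> closure (Omega C) x -> ~ C x.
Proof.
move=> oC Dx Cx; have [y [/= nCy Cy]] := Dx C (open_nbhs_nbhs (conj oC Cx)).
exact/nCy/subset_closure.
Qed.

Lemma Omega_boundary C x : open C -> closure (Omega C) x -> ~ Omega C x -> boundary C x.
Proof.
move=> oC /(closure_Omega_notin oC) nCx /contrapT Cx; split => //.
by move=> /interior_subset.
Qed.

Lemma closure_Omega_sub C L : closure (Omega_ C L) `<=` closure (Omega C).
Proof. by apply: closure_subset => x []. Qed.

Lemma Omega__boundary C L x : open C -> closure (Omega_ C L) x -> ~ Omega_ C L x ->
  enorm x = L \/ boundary C x /\ enorm x < L.
Proof.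
move=> oC Dx nDx; have := closure_Omega_enorm Dx; rewrite le_eqVlt.
move=> /orP[/eqP|xL]; [by left|right; split => //].
by apply: Omega_boundary (closure_Omega_sub Dx) _ => // Cx; exact: nDx.
Qed.

Lemma class_CS k U D f : D `<=` U -> class_C k U f -> class_C k D f.
Proof.
move=> DU; elim: k f => [|k IH] f [cf df]; split => //; try by move=> x /DU; exact: cf.
by move=> i; have [di ci] := df i; split; [move=> x /DU; exact: di|exact: IH].
Qed.

Section obstacle.
Variables (C : set V) (x : V) (U : set V) (g : V -> R).
Hypothesis defC : local_defining_function C x U g.

Lemma defining_closure y : U y -> closure C y -> g y <= 0.
Proof.
have [oU Ux gs gn gC] := defC => Uy Cy; rewrite leNgt; apply/negP => gy.
have : \forall z \near y, U z /\ 0 < g z.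
  near=> z; split; first by near: z; exact: open_nbhs_nbhs.
  near: z; apply: (cvgr_gt (g y)) => //.
  by have [/(_ y Uy)] := gs 2%N.
move=> /Cy[z [Cz [Uz gz]]].
by have := (gC z Uz).1 Cz; rewrite ltNge (ltW gz).
Unshelve. all: by end_near. Qed.

Lemma defining_zero : boundary C x -> open C -> g x = 0.
Proof.
have [oU Ux gs gn gC] := defC => -[Cx nCx] oC.
apply/eqP; rewrite eq_le defining_closure//= leNgt; apply/negP => gx.
by apply: nCx; rewrite (interior_id _).1//; apply/gC.
Qed.

(** The normal points out of [C], whose closure lies in [g <= 0], and [g] increases
    along it at rate [lambda]. *)
Lemma outward_Omega n (lambda : R) : boundary C x -> open C -> enorm n = 1 -> 0 < lambda ->
  gradient g x = lambda *: n -> \forall t \near (0 : R)^'+, Omega C (x + t *: n).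
Proof.
have [oU Ux gs gn gC] := defC => bx oC n1 l0 gxn.
have C1 : class_C 1 U g by exact: gs.
have l2 : 0 < lambda / 2 by rewrite divr_gt0.
have : \forall t \near (0 : R)^'+, `|g (x + t *: n) - g x - t * dot (gradient g x) n|
    <= lambda / 2 * `|t|.
  by apply: cvg_within; exact: class_C1_increment C1 Ux l2.
have nn : dot n n = 1 by rewrite -[LHS]enorm_sqr n1 expr1n.
rewrite gxn dotZl nn (defining_zero bx oC) => H.
near=> t.
have t0 : 0 < t by near: t; exact: nbhs_right_gt.
have Ut : U (x + t *: n) by near: t; exact: near_at_right_line.
have gt : `|g (x + t *: n) - 0 - t * (lambda * 1)| <= lambda / 2 * `|t| by near: t.
move=> /(defining_closure Ut); apply/negP; rewrite -ltNge.
have tl : 0 < t * lambda by rewrite mulr_gt0.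
by move: gt; rewrite (gtr0_norm t0) ler_norml => /andP[+ _]; lra.
Unshelve. all: by end_near. Qed.

End obstacle.

Lemma outer_unit_normal_exists C x : smooth_boundary C -> boundary C x ->
  exists n, outer_unit_normal C x n.
Proof.
move=> sC bx; have [U [g defC]] := sC x bx.
have [oU Ux gs gn gC] := defC.
have e0 : 0 < enorm (gradient g x).
  rewrite lt_neqAle enorm_ge0 andbT; apply/eqP => e0.
  have := norm_le_enorm (gradient g x); rewrite -e0 normr_le0.
  by apply/negP; exact: gn.
exists ((enorm (gradient g x))^-1 *: gradient g x); split.
  apply/eqP; rewrite -(@eqrXn2 _ 2)// ?enorm_ge0// enorm_sqr /sqnorm dotZl dotZr.
  rewrite -/(sqnorm _) -enorm_sqr expr1n; apply/eqP; field.
  by rewrite gt_eqF.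
exists U, g; split => //; exists (enorm (gradient g x)); split => //.
by rewrite scalerA mulfV ?scale1r// gt_eqF.
Qed.

(** The flux [h] on the obstacle cancels in the difference, whatever its values. *)
Lemma insulatedB C L U1 U2 f1 f2 (h : V -> R) x :
  open C -> smooth_boundary C -> boundary C x -> enorm x < L ->
  Omega_ C L `<=` U1 -> Omega_ C L `<=` U2 ->
  neumann_condition U1 f1 C h -> neumann_condition U2 f2 C h ->
  insulated (Omega_ C L) (fun y => f1 y - f2 y) x.
Proof.
move=> oC sC bx xL D1 D2 N1 N2.
have [n nx] := outer_unit_normal_exists sC bx.
have [n1 [U [g [defC [l [l0 gxn]]]]]] := nx.
have [oU Ux gs gn gC] := defC.
have nD : \forall t \near (0 : R)^'+, Omega_ C L (x + t *: n).
  have := near_at_right_line n (@open_eball L) xL.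
  by apply: filterS2 (outward_Omega defC bx oC n1 l0 gxn).
exists (U `&` eball L), g, n; split; split.
- by apply: openI => //; exact: open_eball.
- by [].
- by apply: class_CS (gs 2%N) => y [].
- exact: defining_zero defC bx oC.
- move=> y [Uy yL] Dy nDy; have [yL'|[[+ _] _]] := Omega__boundary oC Dy nDy.
    by move: yL; rewrite /eball /= yL' ltxx.
  exact: defining_closure defC _ Uy.
- by rewrite gxn dotZl -/(sqnorm n) -enorm_sqr n1 expr1n mulr1.
- exact: nD.
- have U1n : \forall t \near (0 : R)^'+, U1 (x + t *: n) by apply: filterS nD => t /D1.
  have U2n : \forall t \near (0 : R)^'+, U2 (x + t *: n) by apply: filterS nD => t /D2.
  have d1 := normal_derivative_right (N1 x n bx nx) U1n.
  have d2 := normal_derivative_right (N2 x n bx nx) U2n.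
  rewrite -[X in _ --> X](subrr (h x)).
  rewrite (_ : (fun t : R => _) = (fun t => t^-1 * (f1 (x + t *: n) - f1 x) -
    t^-1 * (f2 (x + t *: n) - f2 x))); first exact: cvgB.
  by apply/funext => t; rewrite -mulrBr; congr (_ * _); ring.
Qed.

Section sphere.
Variables (L : R) (x : V).
Hypotheses (L0 : 0 < L) (xL : enorm x = L).

Let n := L^-1 *: x.

Let dot_xn : dot x n = L.
Proof. by rewrite dotZr -/(sqnorm x) -enorm_sqr xL; field; rewrite gt_eqF. Qed.

Let sqnorm_n : sqnorm n = 1.
Proof. by rewrite /sqnorm dotZl dot_xn mulVf// gt_eqF. Qed.

Lemma inward_eball : \forall t \near (0 : R)^'-, eball L (x + t *: n).
Proof.
near=> t.
have t0 : t < 0 by near: t; exact: nbhs_left_lt.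
have t1 : - L < t by near: t; apply: nbhs_left_gt; rewrite oppr_lt0.
rewrite /eball /= enorm_lt ?(ltW L0)// sqnorm_line dot_xn sqnorm_n -enorm_sqr xL.
have : t * (2 * L + t) < 0 by rewrite nmulr_rlt0//; lra.
lra.
Unshelve. all: by end_near. Qed.

Lemma boundary_eball : boundary (eball L) x.
Proof.
split; last by move=> /interior_subset; rewrite /eball/= xL ltxx.
move=> B /=; rewrite nbhsE => -[W [oW Wx] WB].
have Wn : \forall t \near (0 : R)^'-, W (x + t *: n) by exact: near_at_left_line.
near (0 : R)^'- => t; exists (x + t *: n); split.
  by near: t; exact: inward_eball.
by apply: WB; near: t.
Unshelve. all: by end_near. Qed.

Lemma outer_unit_normal_eball : outer_unit_normal (eball L) x n.
Proof.
split; first by rewrite enormE sqnorm_n sqrtr1.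
exists [set y | 0 < sqnorm y], (fun y => sqnorm y - L ^+ 2); split; last first.
  exists (2 * L); rewrite mulr_gt0//; split => //.
  by rewrite gradient_sqnorm /n scalerA mulfK ?gt_eqF.
split.
- apply: (@open_comp _ _ sqnorm [set r | 0 < r]); last exact: open_gt.
  by move=> y _; exact: continuous_sqnorm.
- by rewrite /= -enorm_sqr xL exprn_gt0.
- exact: smooth_sqnorm.
- move=> y /= y0; rewrite gradient_sqnorm scaler_eq0 negb_or pnatr_eq0/=.
  by apply: contraTneq y0 => ->; rewrite sqnorm0 ltxx.
- by move=> y _; rewrite /eball /= enorm_lt ?(ltW L0)// subr_lt0.
Qed.

End sphere.

End domains.

(** * Integrals of bounded functions *)

Section L1_bound.
Context {R : realType}.

Import HBNNSimple.

(** The integral is a supremum over simple functions, and each one below [f] is at most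
    [c] on a measurable subset of [D] and zero elsewhere. *)
Lemma ge0_integral_le_cst dT (T : measurableType dT) (mu : {measure set T -> \bar R})
  (D : set T) (f : T -> R) (c : R) (M : \bar R) : (0 <= c) ->
  (forall x, D x -> 0 <= f x <= c) ->
  (forall S, measurable S -> S `<=` D -> (mu S <= M)%E) ->
  (\int[mu]_(x in D) (f x)%:E <= c%:E * M)%E.
Proof.
move=> c0 fc DM; rewrite ge0_integralE; last first.
  by move=> x /fc/andP[f0 _]; rewrite lee_fin.
apply: ge_ereal_sup => _ [h /= hf <-].
pose S := h @^-1` [set r | 0 < r].
have mS : measurable S.
  rewrite /S -[X in measurable X]setTI.
  by apply: measurable_funPT => //; rewrite -set_itvoy; exact: measurable_itv.
have SD : S `<=` D.
  move=> x hx; apply: contrapT => nDx; have := hf x.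
  by rewrite patchE memNset// lee_fin leNgt hx.
apply: (@le_trans _ _ (c%:E * mu S)%E); last by rewrite lee_pmul// ?lee_fin ?DM.
have -> : mu S = sintegral mu (indic_nnsfun R mS).
  by rewrite -sintegral_indic.
rewrite -sintegralrM.
apply: (@le_sintegral _ _ _ mu h (scale_nnsfun (indic_nnsfun R mS) c0)) => x /=.
rewrite measurable_realfun.mindicE; have [xS|xS] := boolP (x \in S).
  have := hf x; rewrite inE in xS; rewrite patchE mem_set ?lee_fin; last exact: SD.
  by rewrite mulr1 => /le_trans; apply; have /andP[] := fc x (SD x xS).
rewrite mulr0 leNgt; apply/negP => hx; move/negP: xS; apply.
by rewrite inE.
Qed.

(** The set [A] followed by empty sets is a cover of [A]. *)
Lemma cover_measure_le (T : pointedType) (zeta : set T -> \bar R) (A : set T) :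
  (forall U, 0 <= zeta U)%E -> (cover_measure zeta A <= zeta A)%E.
Proof.
move=> zeta0; rewrite /cover_measure /mu_ext.
pose gauge (U : set T) := if `[< U = set0 >] then 0%E else zeta U.
have g0 U : (0 <= gauge U)%E by rewrite /gauge; case: asboolP.
pose F (k : nat) : set T := if k is 0%N then A else set0.
apply: (@le_trans _ _ (\sum_(0 <= k <oo) gauge (F k))%E).
  apply: ereal_inf_lbound; exists F => //; split.
    by move=> k; exact: sub_sigma_algebra.
  by move=> x Ax; exists 0%N.
rewrite nneseries_recl// eseries0 ?adde0; last first.
  by move=> [|k]// _ _; rewrite /F /gauge; case: asboolP.
by rewrite /F /gauge; case: asboolP.
Qed.

Lemma L1_norm_le d (D : set 'rV[R]_d) (f : 'rV[R]_d -> R) (c L : R) : 0 < L -> 0 <= c ->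
  (forall x, D x -> enorm x < L) -> (forall x, D x -> `|f x| <= c) ->
  (L1_norm D f <= (c * (2 * L) ^+ d)%:E)%E.
Proof.
move=> L0 c0 DL fc; rewrite EFinM; apply: ge0_integral_le_cst => //.
  by move=> x /fc ->; rewrite normr_ge0.
move=> S _ SD.
pose a : 'rV[R]_d := const_mx (- L); pose b : 'rV[R]_d := const_mx L.
have Sbox : S `<=` box a b.
  move=> x /SD/DL xL i; rewrite !mxE.
  have := le_lt_trans (coord_le_norm x i) (le_lt_trans (norm_le_enorm x) xL).
  by rewrite ltr_norml => /andP[/ltW -> ->].
apply: (le_trans (le_cover_measure _ Sbox)).
apply: (le_trans (cover_measure_le _ (@box_volume_ge0 R d))).
apply: ereal_inf_lbound; exists a, b; split => //.
  by move=> i; rewrite !mxE; lra.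
congr (_ %:E); rewrite (eq_bigr (fun=> 2 * L)).
  by rewrite prodr_const card_ord.
by move=> i _; rewrite !mxE; ring.
Qed.

End L1_bound.

(** * Pointwise estimate of the truncation error *)

Section two_sided.
Context {R : realType} {d : nat}.
Local Notation V := 'rV[R]_d.
Implicit Types (f g u : V -> R) (x y n : V) (U D C : set V) (L k : R).

Lemma closure_le D u (A : R) : {within closure D, continuous u} ->
  (forall x, D x -> u x <= A) -> forall x, closure D x -> u x <= A.
Proof.
move=> /subspace_continuousP cu uA x Dx; rewrite leNgt; apply/negP => Ax.
have Au : \forall y \near within (closure D) (nbhs x), A < u y.
  by apply: (cvgr_gt (u x) (cu x Dx)).
have [y [Dy /(_ (subset_closure Dy))]] := Dx _ Au.
by apply/negP; rewrite -leNgt uA.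
Qed.

Lemma within_norm D u : {within D, continuous u} -> {within D, continuous (fun x => `|u x|)}.
Proof. by move=> cu x; apply: cvg_norm; exact: cu. Qed.

Lemma within_sub D f g : {within D, continuous f} -> {within D, continuous g} ->
  {within D, continuous (fun x => f x - g x)}.
Proof. by move=> cf cg x; apply: cvgB; [exact: cf|exact: cg]. Qed.

Lemma compact_bound D u : compact D -> {within D, continuous u} ->
  exists2 M : R, 0 <= M & forall x, D x -> `|u x| <= M.
Proof.
move=> cD cu; have [D0|D0] := pselect (D !=set0); last first.
  by exists 0 => // x Dx; exfalso; apply: D0; exists x.
have [z _ zmax] := compact_EVT_max D0 cD (within_norm cu).
by exists `|u z| => // x Dx; apply: zmax; rewrite inE.
Qed.

Lemma gauss_decay_norm k D f y (A c rho : R) :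
  0 < k -> open D -> sinh_solution k D f -> {within closure D, continuous f} ->
  0 < A -> (forall x, D x -> `|f x| <= A) -> 0 < c -> 0 < rho ->
  2 * c / rho * d%:R + 4 * c ^+ 2 <= k -> D y ->
  (forall x, closure D x -> ~ D x -> sqnorm (x - y) < rho ^+ 2 ->
    exists n, [/\ 0 < dot (x - y) n, \forall t \near (0 : R)^'-, D (x + t *: n) &
      (fun t : R => t^-1 * (f (x + t *: n) - f x)) @ (0 : R)^'- --> (0 : R)]) ->
  `|f y| <= A * expR (- c * rho).
Proof.
move=> k0 oD fs cf A0 fA c0 rho0 ck Dy Dn.
have fA' := closure_le (within_norm cf) fA.
have c_0 : {within closure D, continuous (fun=> 0 : R)}.
  by apply: continuous_subspaceT => x; exact: cst_continuous.
have s0 := @sinh_solution0 R d k D.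
rewrite ler_norml lerNl; apply/andP; split.
  have -> : - f y = 0 - f y by rewrite sub0r.
  apply: (gauss_decay (u := fun y => 0 - f y) k0 oD (subsolutionB k0 s0 fs)
    (within_sub c_0 cf) A0 _ c0 rho0 ck Dy).
    by move=> x /fA'; rewrite sub0r ler_norml => /andP[]; rewrite lerNl.
  move=> x Dx nDx xy; have [n [xn nD fn]] := Dn x Dx nDx xy; exists n; split => //.
  rewrite -[X in _ --> X]oppr0 (_ : (fun t : R => _) =
    (fun t => - (t^-1 * (f (x + t *: n) - f x)))); first exact: cvgN.
  by apply/funext => t; rewrite -mulrN; congr (_ * _); ring.
have -> : f y = f y - 0 by rewrite subr0.
apply: (gauss_decay (u := fun y => f y - 0) k0 oD (subsolutionB k0 fs s0)
    (within_sub cf c_0) A0 _ c0 rho0 ck Dy).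
  by move=> x /fA'; rewrite subr0 ler_norml => /andP[].
move=> x Dx nDx xy; have [n [xn nD fn]] := Dn x Dx nDx xy; exists n; split => //.
by under eq_fun do rewrite !subr0.
Qed.

(** The difference of two solutions with the same flux on the obstacle is controlled by
    its values on the outer sphere alone. *)
Lemma comparison k C L U1 U2 f1 f2 (h : V -> R) (B : R) :
  0 < k -> 0 <= L -> open C -> smooth_boundary C ->
  Omega_ C L `<=` U1 -> Omega_ C L `<=` U2 ->
  sinh_solution k U1 f1 -> sinh_solution k U2 f2 ->
  {within closure U1, continuous f1} -> {within closure U2, continuous f2} ->
  neumann_condition U1 f1 C h -> neumann_condition U2 f2 C h ->
  0 <= B -> (forall x, closure (Omega_ C L) x -> enorm x = L -> f1 x - f2 x <= B) ->
  forall x, Omega_ C L x -> f1 x - f2 x <= B.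
Proof.
move=> k0 L0 oC sC D1 D2 s1 s2 c1 c2 N1 N2 B0 fB x Dx.
suff : forall y, closure (Omega_ C L) y -> f1 y - f2 y <= B.
  by apply; exact: subset_closure.
apply: (maximum_principle k0 (@open_Omega_ _ _ C L) (@compact_closure_Omega_ _ _ C L L0)) => //.
- by apply: subsolutionB => // y Dy; [apply: s1; exact: D1|apply: s2; exact: D2].
- apply: within_sub.
    by apply: continuous_subspaceW c1; exact: closure_subset.
  by apply: continuous_subspaceW c2; exact: closure_subset.
move=> y Dy nDy; have [yL|[by' yL]] := Omega__boundary oC Dy nDy.
  by left; exact: fB.
by right; exact: insulatedB by' yL D1 D2 N1 N2.
Qed.

Lemma parallelogram x y : sqnorm y <= 2 * sqnorm x + 2 * sqnorm (x - y).
Proof.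
have := sqnorm_ge0 (2 *: x - y); rewrite /sqnorm !dotDl !dotDr !dotNl !dotNr !dotZl !dotZr.
by rewrite (dotC y x); lra.
Qed.

End two_sided.

Section estimate.
Context {R : realType} {d : nat}.
Local Notation V := 'rV[R]_d.
Variables (nu rho_inf : R) (C : set V) (sigma_f Phi : V -> R).
Hypotheses (nu0 : 0 < nu) (rho0 : 0 < rho_inf) (oC : open C)
  (sC : smooth_boundary C) (Phi_sol : exterior_solution nu rho_inf C sigma_f Phi).

Lemma obstacle_bound : bounded_set C ->
  exists2 R0 : R, 0 < R0 & forall x, closure C x -> enorm x <= R0.
Proof.
move=> [M [_ /(_ (`|M| + 1))]]; rewrite (le_lt_trans (ler_norm M)) ?ltrDl// => /(_ isT) CM.
pose r := (d%:R + 1) * (`|M| + 1).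
have M0 : 0 <= `|M| + 1 by rewrite addr_ge0.
exists (r + 1); first by rewrite ltr_wpDl// mulr_ge0// addr_ge0.
apply: (@closure_le _ _ C (@enorm R d)).
  by apply: continuous_subspaceT; exact: continuous_enorm.
have d0 : 0 <= d%:R :> R by [].
move=> x /CM xM; rewrite (@le_trans _ _ r)// ?lerDl// enorm_le ?mulr_ge0 ?addr_ge0//.
rewrite (le_trans (sqnorm_le_norm x))// /r exprMn ler_pM ?sqr_ge0//.
  by rewrite expr2; nra.
by rewrite ler_pXn2r ?nnegrE.
Qed.

(** Near the obstacle by compactness, far away by decay at infinity. *)
Lemma Phi_bound : exists2 M : R, 0 < M & forall x, Omega C x -> `|Phi x| <= M.
Proof.
have [[_ [cP _]] _ _ /(_ 1 ltr01)[r rP]] := Phi_sol.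
have [M M0 PM] := compact_bound (@compact_closure_ball _ _ (Omega C) 0 `|r| (normr_ge0 r))
  (@within_closure_ballS _ _ _ _ 0 `|r| cP).
exists (M + 1); first by rewrite ltr_wpDl.
move=> x Ox; have [xr|rx] := lerP (enorm x) `|r|.
  rewrite (@le_trans _ _ M)// ?lerDl//; apply: PM; split; first exact: subset_closure.
  by rewrite /= subr0 -enorm_le.
by rewrite (@le_trans _ _ 1)// ?lerDr// rP// (le_trans (ler_norm r))// ltW.
Qed.

Variables (R0 M c : R).
Hypotheses (CR0 : forall x, closure C x -> enorm x <= R0) (R0_gt0 : 0 < R0)
  (M0 : 0 < M) (PhiM : forall x, Omega C x -> `|Phi x| <= M) (c0 : 0 < c).

Variables (L : R) (Phi_L : V -> R).
Hypotheses (LR0 : 4 * R0 <= L)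
  (cL : 2 * c / (L / 4) * d%:R + 4 * c ^+ 2 <= rho_inf / nu)
  (Phi_L_sol : truncated_solution nu rho_inf C sigma_f L Phi_L).

Let q := expR (- c * (L / 4)).
Hypothesis q_half : q <= 1 / 2.

Let k := rho_inf / nu.
Let k0 : 0 < k. Proof. by rewrite divr_gt0. Qed.
Let L0 : 0 < L. Proof. by apply: lt_le_trans LR0; rewrite mulr_gt0. Qed.
Let q0 : 0 < q. Proof. exact: expR_gt0. Qed.
Let L4 : 0 < L / 4. Proof. by rewrite divr_gt0. Qed.

(** A ball of radius [L / 4] centred outside the ball of radius [L / 2] does not meet the
   obstacle: this is what [4 * R0 <= L] is for. *)
Let far_from_obstacle x y : closure C x -> L / 2 <= enorm y ->
  sqnorm (x - y) < (L / 4) ^+ 2 -> False.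
Proof.
move=> /CR0; rewrite enorm_le ?(ltW R0_gt0)// => xR yL xy.
have := parallelogram x y; apply/negP; rewrite -ltNge -(enorm_sqr y).
have : (L / 2) ^+ 2 <= enorm y ^+ 2.
  by rewrite ler_pXn2r// ?nnegrE ?enorm_ge0// divr_ge0// ltW.
have : (4 * R0) ^+ 2 <= L ^+ 2.
  by rewrite ler_pXn2r// ?nnegrE ?(ltW L0)// mulr_ge0// ltW.
lra.
Qed.

Let Phi_decay y : Omega C y -> L / 2 <= enorm y -> `|Phi y| <= M * q.
Proof.
have [[C2 [cP _]] PB _ _] := Phi_sol.
move=> Oy yL; apply: (gauss_decay_norm k0 (@open_Omega _ _ C) _ cP M0 PhiM c0 L4 cL Oy).
  exact: poisson_boltzmann_sinh nu0 (@open_Omega _ _ C) C2 PB.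
move=> x Ox nOx xy; exfalso.
exact: (far_from_obstacle (contrapT nOx) yL xy).
Qed.

(** The ball around [y] is cut by the outer sphere; there the derivative of [Phi_L] along
   the normal [x / L] vanishes, and [x / L] points away from [y] since [|y| < L]. *)
Let Phi_L_decay A y : 0 < A -> (forall x, Omega_ C L x -> `|Phi_L x| <= A) ->
  Omega_ C L y -> L / 2 <= enorm y -> `|Phi_L y| <= A * q.
Proof.
have [[C2 [cP _]] PB _ NL] := Phi_L_sol.
move=> A0 PA Oy yL.
apply: (gauss_decay_norm k0 (@open_Omega_ _ _ C L) _ cP A0 PA c0 L4 cL Oy).
  exact: poisson_boltzmann_sinh nu0 (@open_Omega_ _ _ C L) C2 PB.
move=> x Ox nOx xy.
have [xL|[[Cx _] _]] := Omega__boundary oC Ox nOx; last first.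
  by exfalso; exact: (far_from_obstacle Cx yL xy).
have nCx : Omega C x.
  by move=> /CR0; rewrite xL leNgt; apply/negP/negPn; rewrite (lt_le_trans _ LR0)//; have := R0_gt0; lra.
have inw : \forall t \near (0 : R)^'-, Omega_ C L (x + t *: (L^-1 *: x)).
  apply: filterS2 (inward_eball L0 xL) (near_at_left_line (L^-1 *: x) (@open_Omega _ _ C) nCx).
  by move=> t H1 H2; split.
exists (L^-1 *: x); split => //.
- rewrite dotZr mulr_gt0 ?invr_gt0//.
  have yx : enorm y < L by case: Oy.
  have : sqnorm y < sqnorm x.
    by rewrite -!enorm_sqr xL ltr_pXn2r ?nnegrE ?enorm_ge0// ltW.
  have := sqnorm_ge0 (x - y).
  by rewrite /sqnorm !dotDl !dotDr !dotNl !dotNr (dotC y x); lra.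
- apply: normal_derivative_left inw.
  by apply: NL; [exact: boundary_eball|exact: outer_unit_normal_eball].
Qed.

(** In the outer half of the domain both functions are small separately; this bounds the
   difference on the sphere of radius [L / 2], hence inside it. *)
Let difference_bound A x : 0 < A -> (forall x, Omega_ C L x -> `|Phi_L x| <= A) ->
  Omega_ C L x -> `|Phi_L x - Phi x| <= (A + M) * q.
Proof.
have [[C2 [cP _]] PB NP _] := Phi_sol.
have [[C2L [cL' _]] PBL NPL _] := Phi_L_sol.
move=> A0 PA Ox.
have outer y : Omega_ C L y -> L / 2 <= enorm y -> `|Phi_L y - Phi y| <= (A + M) * q.
  move=> Oy yL; rewrite mulrDl (le_trans (ler_normB _ _))//.
  by rewrite lerD ?Phi_L_decay ?Phi_decay//; case: Oy.
have [xL|xL] := lerP (L / 2) (enorm x); first exact: outer.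
have L2L : L / 2 < L by have := L0; lra.
have sub1 : Omega_ C (L / 2) `<=` Omega_ C L.
  by move=> y [yL Oy]; split => //; exact: lt_trans yL L2L.
have sub2 : Omega_ C (L / 2) `<=` Omega C by move=> y [].
have B0 : 0 <= (A + M) * q by rewrite mulr_ge0 ?addr_ge0 ?ltW.
have L20 : 0 <= L / 2 by rewrite divr_ge0 ?ltW.
have sphere y : enorm y = L / 2 -> `|Phi_L y - Phi y| <= (A + M) * q.
  move=> yL; apply: outer; last by rewrite yL.
  split; first by rewrite /eball /= yL.
  by move=> /CR0; rewrite yL leNgt; apply/negP/negPn; have := R0_gt0; have := LR0; lra.
have s1 := poisson_boltzmann_sinh nu0 (@open_Omega_ _ _ C L) C2L PBL.
have s2 := poisson_boltzmann_sinh nu0 (@open_Omega _ _ C) C2 PB.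
have Ox2 : Omega_ C (L / 2) x by case: Ox.
rewrite ler_norml lerNl opprB; apply/andP; split.
  apply: (comparison k0 L20 oC sC sub2 sub1 s2 s1 cP cL' NP NPL B0) Ox2 => y _ yL.
  by have := sphere y yL; rewrite distrC ler_norml => /andP[].
apply: (comparison k0 L20 oC sC sub1 sub2 s1 s2 cL' cP NPL NP B0) Ox2 => y _ yL.
by have := sphere y yL; rewrite ler_norml => /andP[].
Qed.

(** From a bound [A] on [|Phi_L|], [difference_bound] yields the bound
    [M + (A + M) * q] on [|Phi_L|].  For [A] the maximum of [|Phi_L|] (or [M]) and
    [q <= 1 / 2], this forces [A <= 3 * M], a bound that does not depend on [L]. *)
Lemma truncation_error x : Omega_ C L x -> `|Phi_L x - Phi x| <= 4 * M * q.
Proof.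
have [[_ [cP _]] _ _ _] := Phi_L_sol.
move=> Ox; have D0 : closure (Omega_ C L) !=set0 by exists x; exact: subset_closure.
have [z + zmax] := compact_EVT_max D0 (@compact_closure_Omega_ _ _ C L (ltW L0)) (within_norm cP).
rewrite inE => Dz; pose A := Num.max `|Phi_L z| M.
have A0 : 0 < A by rewrite lt_max M0 orbT.
have PA y : Omega_ C L y -> `|Phi_L y| <= A.
  move=> Oy; rewrite le_max; apply/orP; left.
  by apply: zmax; rewrite inE; exact: subset_closure.
have w := difference_bound A0 PA.
have zA : `|Phi_L z| <= M + (A + M) * q.
  apply: (closure_le (within_norm cP)) Dz => y Oy.
  rewrite -[Phi_L y](subrK (Phi y)) (le_trans (ler_normD _ _))// addrC.
  by rewrite lerD ?w// PhiM//; case: Oy.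
have A3 : A <= 3 * M.
  have : (A + M) * q <= (A + M) * (1 / 2).
    by rewrite ler_wpM2l// addr_ge0// ltW.
  have := M0; move: zA; rewrite /A; case: (leP `|Phi_L z| M); lra.
apply: (le_trans (w x Ox)); apply: ler_wpM2r; first exact: ltW.
by rewrite (_ : 4 * M = 3 * M + M) ?lerD2r//; ring.
Qed.

End estimate.

(** * The truncation error in mean *)

Lemma exprn_le_expR (R : realType) (x : R) n : 0 <= x -> x ^+ n <= expR (x * n%:R).
Proof.
move=> x0; rewrite expRM_natr lerXn2r ?nnegrE ?expR_ge0//.
by rewrite (le_trans _ (expR_ge1Dx x))// lerDr.
Qed.

(** Half of the decay rate pays for the volume of the ball of radius [L]. *)
Lemma expR_absorbs_power (R : realType) (c : R) (d : nat) : 0 < c ->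
  exists2 K : R, 0 < K & forall L, 0 < L ->
    expR (- c * (L / 4)) * (2 * L) ^+ d <= K * expR (- (c / 8) * L).
Proof.
move=> c0; pose a := c / (8 * d.+1%:R).
have a0 : 0 < a by rewrite divr_gt0// mulr_gt0.
exists ((2 / a) ^+ d); first by rewrite exprn_gt0// divr_gt0.
move=> L L0.
have -> : 2 * L = 2 / a * (a * L) by field; rewrite gt_eqF.
have -> : - c * (L / 4) = - (c / 8) * L + - (c / 8) * L by field.
have aL : 0 <= a * L by rewrite mulr_ge0// ltW.
rewrite exprMn expRD; set E := expR _; set P := (2 / a) ^+ d.
have -> : E * E * (P * (a * L) ^+ d) = P * E * (E * (a * L) ^+ d) by ring.
rewrite ler_piMr ?mulr_ge0 ?expR_ge0 ?exprn_ge0 ?divr_ge0 ?(ltW a0) ?(ltW c0)// /E.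
rewrite mulNr expRN mulrC ler_pdivrMr ?expR_gt0// mul1r.
rewrite (le_trans (exprn_le_expR d aL))// ler_expR.
have -> : c / 8 * L = a * L * d.+1%:R by rewrite /a; field; rewrite nat1r pnatr_eq0.
by rewrite ler_wpM2l// ler_nat.
Qed.

Unset Implicit Arguments.
Set Strict Implicit.

Theorem theorem4p1 (R : realType) (d : nat) (hd : d = 1%N \/ d = 3%N)
  (nu rho_inf : R) (nu_gt0 : 0 < nu) (rho_inf_gt0 : 0 < rho_inf)
  (C : set 'rV[R]_d)
  (C_open : open C) (C_bounded : bounded_set C) (C_smooth : smooth_boundary C)
  (C_interval : d = 1%N ->
    exists a b : R, a < b /\ C = [set x : 'rV[R]_d | forall i, a < x ord0 i < b])
  (rho_f : 'rV[R]_d -> R)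
  (rho_f_integrable : lebesgue.-integrable C (fun x => (rho_f x)%:E))
  (rho_f_radial : d = 3%N ->
    forall x y : 'rV[R]_d, C x -> C y -> enorm x = enorm y -> rho_f x = rho_f y)
  (Q_f : R) (Q_fE : Q_f = \int[lebesgue]_(x in C) rho_f x)
  (sigma_f : 'rV[R]_d -> R)
  (sigma_f_bounded : exists M : R,
    forall x : 'rV[R]_d, boundary C x -> `|sigma_f x| <= M)
  (sigma_f_charge : nu * (\int[surface]_(x in boundary C) sigma_f x) = Q_f)
  (sigma_f_const : d = 1%N ->
    forall x : 'rV[R]_d, boundary C x -> sigma_f x = Q_f / (2 * nu))
  (Phi : 'rV[R]_d -> R)
  (Phi_sol : exterior_solution nu rho_inf C sigma_f Phi) :
  exists C1 C2 : R, [/\ 0 < C1, 0 < C2 &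
    \forall L \near +oo, closure C `<=` @eball R d L ->
      forall Phi_L : 'rV[R]_d -> R,
        truncated_solution nu rho_inf C sigma_f L Phi_L ->
        (L1_norm (Omega_ C L) (fun x => (Phi_L x - Phi x)%R)
           <= (C2 * expR (- (C1 / Num.sqrt nu) * L))%:E)%E].
Proof.
have [R0 R0_gt0 CR0] := obstacle_bound C_bounded.
have [M M0 PhiM] := Phi_bound Phi_sol.
have k0 : 0 < rho_inf / nu by rewrite divr_gt0.
pose k := rho_inf / nu.
(* the bounds [c <= 1] and [c <= k / 8] give [4 * c ^+ 2 <= k / 2] *)
pose c := Num.min 1 (k / 8).
have c0 : 0 < c by rewrite lt_min ltr01 divr_gt0.
have ck : 4 * c ^+ 2 <= k / 2.
  have c1 : c <= 1 by rewrite ge_min lexx.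
  have c8 : c <= k / 8 by rewrite ge_min lexx orbT.
  have : c * c <= c * 1 by rewrite ler_wpM2l// ltW.
  by rewrite expr2; lra.
have [K K0 HK] := expR_absorbs_power d c0.
exists (Num.sqrt nu * (c / 8)), (4 * M * K); split.
- by rewrite mulr_gt0 ?sqrtr_gt0// divr_gt0.
- by rewrite !mulr_gt0.
(* [4 / c <= L] gives [q <= 1 / 2] in [truncation_error]; the lower
   bound with [d] makes the Gaussian barrier a supersolution. *)
near=> L => CL Phi_L Phi_L_sol.
have LR0 : 4 * R0 <= L by near: L; apply: nbhs_pinfty_ge; exact: num_real.
have Lc : 4 / c <= L by near: L; apply: nbhs_pinfty_ge; exact: num_real.
have Ld : 16 * c * d%:R / k <= L by near: L; apply: nbhs_pinfty_ge; exact: num_real.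
have L0 : 0 < L by apply: lt_le_trans Lc; rewrite divr_gt0.
have cL : 2 * c / (L / 4) * d%:R + 4 * c ^+ 2 <= rho_inf / nu.
  have : 2 * c / (L / 4) * d%:R <= k / 2.
    rewrite (_ : _ * _ = 8 * c * d%:R / L); last by field; rewrite gt_eqF.
    by rewrite ler_pdivrMr//; move: Ld; rewrite ler_pdivrMr//; lra.
  by rewrite -/k; lra.
have q2 : expR (- c * (L / 4)) <= 1 / 2.
  rewrite mulNr expRN div1r lef_pV2 ?posrE ?expR_gt0//.
  apply: le_trans (expR_ge1Dx _).
  by move: Lc; rewrite ler_pdivrMr//; lra.
have -> : - (Num.sqrt nu * (c / 8) / Num.sqrt nu) = - (c / 8).
  by field; rewrite gt_eqF// sqrtr_gt0.
have err := truncation_error nu_gt0 rho_inf_gt0 C_open C_smooth Phi_sol CR0 R0_gt0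
  M0 PhiM c0 LR0 cL Phi_L_sol q2.
have q0 := expR_ge0 (- c * (L / 4)).
have M4 : 0 <= 4 * M by rewrite mulr_ge0// ltW.
apply: (le_trans (L1_norm_le L0 (mulr_ge0 M4 q0) _ err)).
  by move=> x [].
by rewrite lee_fin -!mulrA [in leLHS]mulrA [in leRHS]mulrA ler_wpM2l// HK.
Unshelve. all: by end_near. Qed.
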